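(* For every $k\geq 4$ and every $\alpha\geq 1$, any (perhaps randomized) distributed $\alpha$-approximation algorithm in the CONGEST model for the weighted undirected $k$-spanner problem takes $\Omega\!\left(\frac{n}{k\cdot\log n}\right)$ rounds on some $n$-vertex input graphs.
   Context: Weighted $k$-spanner: the input is a connected undirected graph $G=(V,E)$ with a non-negative weight $w(e)$ on each edge (weights are costs; every edge has length 1). A subgraph $H\subseteq E$ is a $k$-spanner if for every edge $\{u,v\}\in E$ there is a path with at most $k$ edges between $u$ and $v$ in $H$. The goal is a $k$-spanner minimizing $w(H)=\sum_{e\in H}w(e)$; an $\alpha$-approximation outputs a $k$-spanner of cost at most $\alpha$ times the minimum. Distributed setting: the input graph is the communication network; vertices have unique IDs and initially know only their incident edges and weights; synchronous rounds; each vertex outputs a subset of its incident edges and the union is the spanner. CONGEST: each vertex may send an $O(\log n)$-bit message over each incident edge per round. *)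

(* Defs.v *)
From mathcomp Require Export all_boot all_order all_algebra.
From mathcomp Require Export all_classical all_reals all_analysis.

Set Implicit Arguments.
Unset Strict Implicit.
Unset Printing Implicit Defensive.

Import Order.TTheory GRing.Theory Num.Theory.
Local Open Scope classical_set_scope.
Local Open Scope ring_scope.

(* An edge is a two-element vertex set, so the weight function is symmetric by
   construction; values of [weight] outside [edges] are irrelevant. The unique
   identifiers are drawn from ['I_M]. *)
Record network (R : realType) (n M : nat) := Network {
  edges : {set {set 'I_n}};
  edges_card2 : forall e, e \in edges -> #|e| = 2%N;
  edges_connected :
    forall u v, connect (fun x y => [set x; y]%SET \in edges) u v;
  weight : {set 'I_n} -> R;
  weight_ge0 : forall e, e \in edges -> 0 <= weight e;
  ident : 'I_n -> 'I_M;
  ident_inj : injective ident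
}.

Section Spanner.
Context {R : realType} {n M : nat}.
Implicit Types (G : network R n M) (H : {set {set 'I_n}}).

Definition spanner (k : nat) G H : Prop :=
  H \subset edges G /\
  forall u v, [set u; v]%SET \in edges G ->
    exists p : seq 'I_n,
      [/\ path (fun x y => [set x; y]%SET \in H) u p, uniq (u :: p),
          last u p = v & (size p <= k)%N].

Definition cost G H : R := \sum_(e in H) weight G e.

Definition min_spanner (k : nat) G H : Prop :=
  spanner k G H /\ forall H', spanner k G H' -> cost G H <= cost G H'.

Definition approx_spanner (k : nat) (alpha : R) G H : Prop :=
  spanner k G H /\
  forall Hmin, min_spanner k G Hmin -> cost G H <= alpha * cost G Hmin.

Definition weights_in (W : set R) G : Prop :=
  forall e, e \in edges G -> W (weight G e).

End Spanner.

(* A synchronous message-passing algorithm whose messages have at most [B]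
   bits (the empty message stands for silence). In every round, and once at the
   start, each vertex draws a fresh private uniform element of [coin]; a
   deterministic algorithm has a one-element [coin].
   - [init i f c]: the initial state of the vertex with identifier [i], where
     [f j = Some w] iff it has a neighbour with identifier [j], along an edge of
     weight [w].
   - [send s j]: the message to the neighbour with identifier [j].
   - [step s inbox c]: the next state, where [inbox j = Some m] iff the
     neighbour with identifier [j] sent [m].
   - [out s = Some S]: the vertex has terminated, choosing its incident edges
     towards the neighbours with identifiers in [S]; this is irrevocable. *)
Record algorithm (R : realType) (M B : nat) := Algorithm {
  state : Type;
  coin : finType;
  coin0 : coin;
  init : 'I_M -> {ffun 'I_M -> option R} -> coin -> state;
  send : state -> 'I_M -> B.-bseq bool;
  step : state -> {ffun 'I_M -> option (B.-bseq bool)} -> coin -> state;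
  out : state -> option {set 'I_M};
  out_step : forall s inbox c S, out s = Some S -> out (step s inbox c) = Some S
}.

Section Execution.
Context {R : realType} {n M B : nat} (A : algorithm R M B) (G : network R n M).

Definition neighbour (v : 'I_n) (j : 'I_M) : option 'I_n :=
  [pick u | ([set v; u]%SET \in edges G) && (ident G u == j)].

Definition view (v : 'I_n) : {ffun 'I_M -> option R} :=
  [ffun j => omap (fun u => weight G [set v; u]%SET) (neighbour v j)].

Definition inbox (st : 'I_n -> state A) (v : 'I_n) :
    {ffun 'I_M -> option (B.-bseq bool)} :=
  [ffun j => omap (fun u => send (st u) (ident G v)) (neighbour v j)].

Fixpoint run (w : 'I_n -> nat -> coin A) (t : nat) : 'I_n -> state A :=
  match t with
  | 0%N => fun v => init (ident G v) (view v) (w v 0%N)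
  | t'.+1 => fun v =>
      step (run w t' v) (inbox (run w t') v) (w v t'.+1)
  end.

(* The coins that the first [t] rounds depend on, and their uniform law. *)
Definition coins (t : nat) : finType := {ffun 'I_n * 'I_t.+1 -> coin A}.

Definition prob (t : nat) (P : coins t -> Prop) : R :=
  #|[set w : coins t | `[< P w >] ]%SET|%:R / #|coins t|%:R.

Definition run_coins (t : nat) (w : coins t) : 'I_n -> state A :=
  run (fun v i => w (v, inord i)) t.

Definition halted (t : nat) (w : coins t) : Prop :=
  forall v, out (run_coins w v) <> None.

Definition output (t : nat) (w : coins t) : {set {set 'I_n}} :=
  [set e in edges G | [exists v, exists u,
     (e == [set v; u]%SET) &&
     (if out (run_coins w v) is Some X then ident G u \in X else false)]]%SET.

(* The events below increase with [t] because outputs are irrevocable, so the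
   supremum is the probability that the algorithm ever terminates with an
   [alpha]-approximate [k]-spanner. *)
Definition success_prob (k : nat) (alpha : R) : R :=
  sup (range (fun t : nat =>
    prob (fun w : coins t => halted w /\ approx_spanner k alpha G (output w)))).

(* With probability at least [delta], the number of rounds until every vertex
   has terminated is at least [r]. *)
Definition rounds_at_least (r delta : R) : Prop :=
  forall t : nat, t%:R < r -> delta <= prob (fun w : coins t => ~ halted w).

End Execution.

(* Success with probability at least 2/3 on every [n]-vertex input whose edge
   weights lie in [W]. *)
Definition approximation_algorithm (R : realType) (n M B : nat)
    (W : set R) (k : nat) (alpha : R) (A : algorithm R M B) : Prop :=
  forall G : network R n M, weights_in W G -> 2%:R / 3%:R <= success_prob A G k alpha.

(* Messages of [O(log n)] bits, with hidden constant [b]. *)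
Definition congest_algorithm (R : realType) (n M b : nat) :=
  algorithm R M (b * up_log 2 n)%N.

(* Main.v *)
Require Import Defs.
From mathcomp Require Import ring lra zify.

Set Implicit Arguments.
Unset Strict Implicit.
Unset Printing Implicit Defensive.

Import Order.TTheory GRing.Theory Num.Theory.
Local Open Scope ring_scope.

(** Let [l = Theta(n/k)] and let [a], [b] be sets of pairs [(i, j)], [i, j < l].
    In the network [G(a, b)], Alice's vertices [x_i], [y_j] are joined by an edge
    of weight 1 iff [(i, j)] is in [a]; all other edges have weight 0 and belong
    to Bob: [x_i] is joined to [x'_i], [y_j] to [y'_j] by a path of length
    [k - 2], and [x'_i] to [y'_j] iff [(i, j)] is not in [b] (a hub makes the
    graph connected, but paths through it are longer than [k]). The edges of
    weight 0 form a [k]-spanner iff [a] and [b] are disjoint. Hence an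
    approximation algorithm, whatever its ratio, outputs only edges of weight 0
    with probability about 2/3 if [a] and [b] are disjoint, and at most about
    1/3 otherwise.

    Only [O(l)] edges join the two sides, so for a [T]-round algorithm that
    probability is a sum of [exp (O(T l log n))] functions [alpha(a) beta(b)]
    with values in [0, 1], one for each transcript of the cut. By the corruption
    bound for set disjointness on [l^2] coordinates, such a sum needs
    [exp (Omega(l^2))] terms: if [alpha] has mean at least [exp (- eps l^2)] on a
    subcube, then for most coordinates its restrictions to the two halves have
    comparable means, so that a product which is large on disjoint pairs is also
    large on pairs that meet in one point. Thus [T = Omega(n / (k log n))]. *)

(** * Corruption bound for set disjointness *)

Section Corruption.
Variables (R : realType) (I : finType).
Implicit Types (f : {set I} -> R) (i : I) (D r S : {set I}).

Definition hi f i : R := \sum_(r : {set I} | i \in r) f r.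
Definition lo f i : R := \sum_(r : {set I} | i \notin r) f r.

Lemma hi_lo f i : hi f i + lo f i = \sum_(r : {set I}) f r.
Proof. by rewrite /hi /lo [RHS](bigID (fun r : {set I} => i \in r)). Qed.

Lemma sum_setU1 (h : {set I} -> R) i :
  \sum_(r : {set I} | i \in r) h r = \sum_(r : {set I} | i \notin r) h (i |: r).
Proof.
rewrite (reindex_onto (fun r : {set I} => i |: r) (fun r => r :\ i)) /=.
  apply: eq_bigl => r; rewrite setU11 /=; apply/eqP/idP => [<-|ir].
    by rewrite !inE eqxx.
  by rewrite setU1K.
by move=> r ir; rewrite finset.setD1K.
Qed.

Lemma sum_set_cst : \sum_(r : {set I}) 1 = 2 ^+ #|I| :> R.
Proof.
rewrite sumr_const (eq_card (B := powerset [set: I]%SET)); last first.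
  by move=> r; rewrite powersetE finset.subsetT.
by rewrite card_powerset cardsT natrX.
Qed.

Lemma hi_cst i : hi (fun=> 1) i = 2 ^+ #|I| / 2.
Proof.
have e : hi (fun=> 1) i = lo (fun=> 1) i by rewrite /hi sum_setU1.
have := hi_lo (fun=> 1) i; rewrite -e sum_set_cst => <-.
by field.
Qed.

Lemma lo_cst i : lo (fun=> 1) i = 2 ^+ #|I| / 2.
Proof. by rewrite -(hi_cst i) /hi sum_setU1. Qed.

(* Tilt the uniform measure by the factor 16/15 off [r] and 14/15 on [r] for
   each coordinate of [S]; these exceed [exp (1/16)] and [exp (-1/14)], and the
   convexity of the exponential does the rest. *)
Lemma bias_bound f S :
  (forall r, 0 <= f r <= 1) ->
  (forall i, i \in S -> hi f i <= 3%:R / 4%:R * lo f i) ->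
  \sum_(r : {set I}) f r <= 2 ^+ #|I| * expR (- (#|S|%:R / 200%:R)).
Proof.
move=> f01 bias.
pose q i r : R := if i \in r then - (1 / 14%:R) else 1 / 16%:R.
pose W r := expR (\sum_(i in S) q i r).
have e1 : expR (- (1 / 14%:R)) <= 14%:R / 15%:R :> R.
  have h := expR_ge1Dx (1 / 14%:R : R).
  rewrite expRN -div1r ler_pdivrMr ?expR_gt0 //.
  by move: h; set e := expR _; lra.
have e0 : expR (1 / 16%:R) <= 16%:R / 15%:R :> R.
  have h := expR_ge1Dx (- (1 / 16%:R) : R).
  rewrite -[1 / 16%:R]opprK expRN -div1r ler_pdivrMr ?expR_gt0 //.
  by move: h; set e := expR _; lra.
have sumW : \sum_(r : {set I}) W r <= 2 ^+ #|I|.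
  pose F i : R := if i \in S then 14%:R / 15%:R else 1.
  pose G i : R := if i \in S then 16%:R / 15%:R else 1.
  have -> : 2 ^+ #|I| = \prod_i (F i + G i).
    rewrite (eq_bigr (fun=> 2)); first by rewrite prodr_const.
    by move=> i _; rewrite /F /G; case: ifP => _; lra.
  rewrite bigA_distr; apply: ler_sum => r _.
  rewrite /W expR_sum big_mkcond /=; apply: ler_prod => i _.
  rewrite /q /F /G; case: (i \in S); case: (i \in r);
    by rewrite ?ler01 ?lexx ?expR_ge0 //=.
set s := #|S|%:R / 200%:R : R.
(* This is [exp u >= 1 + u] with [u] shifted down by [s]; the shift is spread as 1/200 over each
   coordinate of [S]. *)
have Wlb r : expR s * (1 + \sum_(i in S) (q i r - 1 / 200%:R)) <= W r.
  have -> : W r = expR s * expR (\sum_(i in S) (q i r - 1 / 200%:R)).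
    rewrite -expRD sumrB sumr_const /s -[1 / _ *+ _]mulr_natr; congr expR.
    by ring.
  by rewrite ler_pM2l ?expR_gt0 // expR_ge1Dx.
suff h : expR s * (\sum_(r : {set I}) f r) <= 2 ^+ #|I|.
  by rewrite expRN ler_pdivlMr ?expR_gt0 // mulrC.
apply: le_trans sumW.
apply: (@le_trans _ _ (\sum_(r : {set I}) f r * W r)); last first.
  apply: ler_sum => r _; have /andP[f0 f1] := f01 r.
  by rewrite ler_piMl // expR_ge0.
apply: (@le_trans _ _
  (\sum_(r : {set I})
     f r * (expR s * (1 + \sum_(i in S) (q i r - 1 / 200%:R))))); last first.
  by apply: ler_sum => r _; have /andP[f0 f1] := f01 r; apply: ler_wpM2l.
under [leRHS]eq_bigr => r _ do rewrite mulrCA mulrDr mulr1.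
rewrite -mulr_sumr ler_pM2l ?expR_gt0 // big_split /= lerDl.
under eq_bigr => r _ do rewrite mulr_sumr.
rewrite exchange_big /=; apply: sumr_ge0 => i iS.
rewrite (bigID (fun r : {set I} => i \in r)) /=.
rewrite (eq_bigr (fun r => f r * (- (1 / 14%:R) - 1 / 200%:R))); last first.
  by move=> r ir; rewrite /q ir.
rewrite [X in _ + X](eq_bigr (fun r => f r * (1 / 16%:R - 1 / 200%:R))); last first.
  by move=> r /negbTE ir; rewrite /q ir.
rewrite -!mulr_suml.
(* The constant 200 is small enough a loss: 3/4 * (1/14 + 1/200) < 1/16 - 1/200. *)
have h := bias i iS; rewrite /hi /lo in h.
have lo0 : 0 <= \sum_(r : {set I} | i \notin r) f r.
  by apply: sumr_ge0 => r _; case/andP: (f01 r).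
by lra.
Qed.

Definition bad f i := hi f i < 3%:R / 4%:R * lo f i.

(** Two cases, one for each term on the right: either at most |I|/640 coordinates are bad, or
    [bias_bound] applied to the bad set makes the sum of [f] itself tiny, with 128000 = 640 *
    200. *)
Lemma bad_count f :
  (forall r, 0 <= f r <= 1) ->
  (\sum_(r : {set I}) f r) * #|[set i | bad f i]|%:R <=
    #|I|%:R / 640%:R * \sum_(r : {set I}) f r +
    #|I|%:R * (2 ^+ #|I| * expR (- (#|I|%:R / 128000%:R))).
Proof.
move=> f01; set S := [set i | bad f i].
have sf : 0 <= \sum_(r : {set I}) f r.
  by apply: sumr_ge0 => r _; case/andP: (f01 r).
have e0 : 0 <= 2 ^+ #|I| * expR (- (#|I|%:R / 128000%:R)) :> R.
  by rewrite mulr_ge0 ?exprn_ge0 ?expR_ge0.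
have [le|lt] := lerP (#|S|%:R : R) (#|I|%:R / 640%:R).
  rewrite mulrC; apply: le_trans (ler_wpM2r sf le) _.
  by rewrite lerDl mulr_ge0.
have leS : (#|S|%:R <= #|I|%:R :> R) by rewrite ler_nat max_card.
have b : \sum_(r : {set I}) f r <= 2 ^+ #|I| * expR (- (#|I|%:R / 128000%:R)).
  apply: (@le_trans _ _ (2 ^+ #|I| * expR (- (#|S|%:R / 200%:R)))).
    by apply: bias_bound => // i; rewrite inE => /ltW.
  rewrite ler_wpM2l ?exprn_ge0 // ler_expR; lra.
apply: (@le_trans _ _ (#|I|%:R * (2 ^+ #|I| * expR (- (#|I|%:R / 128000%:R))))).
  by rewrite mulrC; apply: ler_pM.
rewrite lerDr; apply: mulr_ge0; [apply: divr_ge0; exact: ler0n|exact: sf].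
Qed.

Section Rectangles.
Variables (Tau : finType) (al be : Tau -> {set I} -> R) (p0 p1 : R).
Hypothesis al01 : forall t x, 0 <= al t x <= 1.
Hypothesis be01 : forall t x, 0 <= be t x <= 1.
Let P x y := \sum_t al t x * be t y.
Hypothesis P_le1 : forall x y, P x y <= 1.
Hypothesis P_disjoint : forall x y, x :&: y = finset.set0 -> p0 <= P x y.
Hypothesis P_meet : forall x y i, x :&: y = [set i]%SET -> P x y <= p1.
Hypothesis I_gt0 : (0 < #|I|)%N.
Hypothesis few : 640%:R * #|Tau|%:R <= expR (#|I|%:R / 128000%:R) :> R.

(* Disjoint inputs are generated from a random partition [D], [~: D] of the
   coordinates as random subsets of the two parts; an input pair meeting exactly
   in [i] arises when both parts are given [i]. *)
Let fa t D r := al t (r :&: D).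
Let fb t D r := be t (r :\: D).
(** The number of tuples [(i, D, r, r')] with [i] in [D] and [i] in both of [r], [r']; equally, with
    [i] in neither. *)
Let Z : R := #|I|%:R * (2 ^+ #|I| / 2) ^+ 3.

Let sum4 (g : I -> {set I} -> R) (c : R) :
  (forall i D, i \in D -> g i D = c) ->
  \sum_i \sum_(D : {set I} | i \in D) g i D = #|I|%:R * ((2 ^+ #|I| / 2) * c).
Proof.
move=> h; rewrite (eq_bigr (fun=> (2 ^+ #|I| / 2) * c)).
  by rewrite sumr_const -[LHS]mulr_natl.
move=> i _; rewrite (eq_bigr (fun D => 1 * c)) -?mulr_suml; last first.
  by move=> D iD; rewrite h // mul1r.
by rewrite -(hi_cst i).
Qed.

Let sum_prod (Q Q' : pred {set I}) (F G : Tau -> {set I} -> R) :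
  \sum_t (\sum_(r : {set I} | Q r) F t r) * (\sum_(r : {set I} | Q' r) G t r) =
  \sum_(r : {set I} | Q r) \sum_(r' : {set I} | Q' r') \sum_t F t r * G t r'.
Proof.
under eq_bigr => t _ do rewrite mulr_suml.
rewrite exchange_big; apply: eq_bigr => r _ /=.
under eq_bigr => t _ do rewrite mulr_sumr.
by rewrite exchange_big.
Qed.

(** Alice's part is [D] and Bob's is the complement of [D :\ i]; these parts overlap only in [i],
    and here both samples contain it. *)
Let S1 : \sum_i \sum_(D : {set I} | i \in D) \sum_t
   hi (fa t D) i * hi (fb t (D :\ i)) i <= p1 * Z.
Proof.
apply: (@le_trans _ _ (\sum_i \sum_(D : {set I} | i \in D)
    (p1 * (hi (fun=> 1) i * hi (fun=> 1) i)))); last first.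
  rewrite (sum4 (c := p1 * (2 ^+ #|I| / 2) ^+ 2)) => [|i D _].
    by rewrite /Z; lra.
  by rewrite !hi_cst expr2.
apply: ler_sum => i _; apply: ler_sum => D iD.
rewrite /hi sum_prod mulr_suml mulr_sumr; apply: ler_sum => r ir.
rewrite mulr_sumr mulr_sumr; apply: ler_sum => r' ir'.
rewrite !mulr1; apply: (P_meet (i := i)); apply/setP => j; rewrite !inE.
have [->|] := eqVneq j i; first by rewrite ir ir' iD.
by case: (j \in D); rewrite ?andbF.
Qed.

Let S0 : p0 * Z <= \sum_i \sum_(D : {set I} | i \in D) \sum_t
   lo (fa t D) i * lo (fb t (D :\ i)) i.
Proof.
apply: (@le_trans _ _ (\sum_i \sum_(D : {set I} | i \in D)
    (p0 * (lo (fun=> 1) i * lo (fun=> 1) i)))).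
  rewrite (sum4 (c := p0 * (2 ^+ #|I| / 2) ^+ 2)) => [|i D _].
    by rewrite /Z; lra.
  by rewrite !lo_cst expr2.
apply: ler_sum => i _; apply: ler_sum => D iD.
rewrite /lo sum_prod mulr_suml mulr_sumr; apply: ler_sum => r ir.
rewrite mulr_sumr mulr_sumr; apply: ler_sum => r' ir'.
rewrite !mulr1; apply: P_disjoint; apply/setP => j; rewrite !inE.
have [->|] := eqVneq j i; first by rewrite (negbTE ir).
by case: (j \in D); rewrite ?andbF.
Qed.

(** This equals [Z / 40]; the two kinds of bad coordinate each cost one [err], hence the 1/20 in the
    final bound. *)
Let err : R := #|I|%:R * (2 ^+ #|I|) ^+ 3 * (1 / 320%:R).

Let sum_fa t D := \sum_(r : {set I}) fa t D r.
Let sum_fb t D := \sum_(r : {set I}) fb t D r.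

Let fa01 t D r : 0 <= fa t D r <= 1. Proof. exact: al01. Qed.
Let fb01 t D r : 0 <= fb t D r <= 1. Proof. exact: be01. Qed.

Let sum01 (f : {set I} -> R) :
  (forall r, 0 <= f r <= 1) -> 0 <= \sum_(r : {set I}) f r <= 2 ^+ #|I|.
Proof.
move=> f01; rewrite sumr_ge0 => [|r _]; last by case/andP: (f01 r).
by rewrite -sum_set_cst; apply: ler_sum => r _; case/andP: (f01 r).
Qed.

Let E : R := 2 ^+ #|I| * expR (- (#|I|%:R / 128000%:R)).

(** For fixed [D], the main terms sum over [t] to at most |I|/640 times the number of pairs
    [(r, r')], because [P] is at most 1. By [few] the exponentially small terms contribute no more
    than that again. *)
Let total_bound (c : Tau -> {set I} -> R) :
  (forall t D, c t D <= #|I|%:R / 640%:R * (sum_fa t D * sum_fb t D) +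
     #|I|%:R * E * 2 ^+ #|I|) ->
  \sum_(D : {set I}) \sum_t c t D <= err.
Proof.
move=> h; apply: (@le_trans _ _ (\sum_(D : {set I})
    (#|I|%:R / 640%:R * (2 ^+ #|I|) ^+ 2 +
     #|I|%:R * ((2 ^+ #|I|) ^+ 2 / 640%:R)))); last first.
  rewrite -[X in _ * X + _]mulr1 -[X in _ <= X]mul1r.
  rewrite (eq_bigr (fun D => 1 * (#|I|%:R / 320%:R * (2 ^+ #|I|) ^+ 2))).
    by rewrite -mulr_suml sum_set_cst /err; lra.
  by move=> D _; lra.
apply: ler_sum => D _.
apply: (@le_trans _ _ (\sum_t (#|I|%:R / 640%:R * (sum_fa t D * sum_fb t D) +
     #|I|%:R * E * 2 ^+ #|I|))); first by apply: ler_sum.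
rewrite big_split /= -mulr_sumr sumr_const; apply: lerD.
  apply: ler_wpM2l; first by apply: divr_ge0; exact: ler0n.
  rewrite /sum_fa /sum_fb sum_prod expr2 -{1}sum_set_cst.
  rewrite mulr_suml; apply: ler_sum => r _.
  by rewrite mul1r -sum_set_cst; apply: ler_sum => r' _; apply: P_le1.
rewrite -mulrA -mulrnAr ler_wpM2l // /E.
have e0 := expR_gt0 (#|I|%:R / 128000%:R : R); have few_ := few.
have p2 : 0 <= 2 ^+ #|I| :> R by rewrite exprn_ge0.
rewrite expRN -mulr_natr.
set e := expR _ in e0 few_ *; set p := 2 ^+ _ in p2 *.
have -> : p * e^-1 * p * #|Tau|%:R = p ^+ 2 * (#|Tau|%:R / e) by ring.
rewrite ler_wpM2l ?exprn_ge0 // ler_pdivrMr //; lra.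
Qed.

(** The sum over [i] is exchanged with the one over [D], so that it counts bad coordinates of a
    fixed function. On samples omitting [i], [D :\ i] may be replaced by [D], so the factor for Bob
    no longer depends on [i]. *)
Let bad_a : \sum_i \sum_(D : {set I} | i \in D) \sum_t
   (if bad (fa t D) i then lo (fa t D) i * lo (fb t (D :\ i)) i else 0) <= err.
Proof.
apply: le_trans (total_bound (c := fun t D =>
  sum_fa t D * #|[set i | bad (fa t D) i]|%:R * sum_fb t D) _); last first.
  move=> t D; have /andP[a0 a1] := sum01 (fa01 t D).
  have /andP[b0 b1] := sum01 (fb01 t D).
  apply: le_trans (ler_wpM2r b0 (bad_count (fa01 t D))) _.
  rewrite mulrDl -!mulrA lerD2l ler_wpM2l // ler_wpM2l ?exprn_ge0 //.
  by rewrite ler_wpM2l ?expR_ge0.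
under eq_bigr => i _ do rewrite big_mkcond.
rewrite exchange_big; apply: ler_sum => D _ /=.
apply: (@le_trans _ _ (\sum_i \sum_t
   (if bad (fa t D) i then sum_fa t D * sum_fb t D else 0))).
  apply: ler_sum => i _; have s0 t : 0 <= sum_fa t D * sum_fb t D.
    have /andP[a0 _] := sum01 (fa01 t D); have /andP[b0 _] := sum01 (fb01 t D).
    exact: mulr_ge0.
  case: ifP => iD; last by apply: sumr_ge0 => t _; case: ifP.
  apply: ler_sum => t _; case: ifP => // _.
  apply: ler_pM.
  - by apply: sumr_ge0 => r _; case/andP: (fa01 t D r).
  - by apply: sumr_ge0 => r _; case/andP: (fb01 t (D :\ i) r).
  - rewrite /sum_fa -(hi_lo _ i) lerDr.
    by apply: sumr_ge0 => r _; case/andP: (fa01 t D r).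
  - rewrite /sum_fb -(hi_lo _ i); apply: (@le_trans _ _ (lo (fb t D) i)).
      apply: ler_sum => r ir; rewrite /fb (_ : r :\: (D :\ i) = r :\: D) //.
      apply/setP => j; rewrite !inE; have [->|] //= := eqVneq j i.
      by rewrite (negbTE ir) !andbF.
    by rewrite lerDr; apply: sumr_ge0 => r _; case/andP: (fb01 t D r).
rewrite exchange_big; apply: ler_sum => t _ /=.
by rewrite -big_mkcond /= sumr_const -[X in X <= _]mulr_natr cardsE mulrAC.
Qed.

(** As for [bad_a], after reindexing by [D :\ i], which makes Bob's function independent of [i];
    Alice's set [i |: D] then reduces to [D] on samples omitting [i]. *)
Let bad_b : \sum_i \sum_(D : {set I} | i \in D) \sum_t
   (if bad (fb t (D :\ i)) i then lo (fa t D) i * lo (fb t (D :\ i)) i else 0) <= err.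
Proof.
apply: le_trans (total_bound (c := fun t D =>
  sum_fb t D * #|[set i | bad (fb t D) i]|%:R * sum_fa t D) _); last first.
  move=> t D; have /andP[a0 a1] := sum01 (fa01 t D).
  have /andP[b0 b1] := sum01 (fb01 t D).
  apply: le_trans (ler_wpM2r a0 (bad_count (fb01 t D))) _.
  rewrite mulrDl -/(sum_fb t D) [sum_fa _ _ * _]mulrC -!mulrA.
  rewrite lerD2l ler_wpM2l // ler_wpM2l ?exprn_ge0 //.
  by rewrite ler_wpM2l ?expR_ge0.
under eq_bigr => i _ do rewrite sum_setU1 big_mkcond.
rewrite exchange_big; apply: ler_sum => D _ /=.
apply: (@le_trans _ _ (\sum_i \sum_t
   (if bad (fb t D) i then sum_fb t D * sum_fa t D else 0))).
  apply: ler_sum => i _; have s0 t : 0 <= sum_fb t D * sum_fa t D.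
    have /andP[a0 _] := sum01 (fa01 t D); have /andP[b0 _] := sum01 (fb01 t D).
    exact: mulr_ge0.
  case: ifP => iD; last by apply: sumr_ge0 => t _; case: ifP.
  rewrite setU1K //.
  apply: ler_sum => t _; case: ifP => // _; rewrite mulrC.
  apply: ler_pM.
  - by apply: sumr_ge0 => r _; case/andP: (fb01 t D r).
  - by apply: sumr_ge0 => r _; case/andP: (fa01 t (i |: D) r).
  - rewrite /sum_fb -(hi_lo _ i) lerDr.
    by apply: sumr_ge0 => r _; case/andP: (fb01 t D r).
  - rewrite /sum_fa -(hi_lo _ i); apply: (@le_trans _ _ (lo (fa t D) i)).
      apply: ler_sum => r ir; rewrite /fa (_ : r :&: (i |: D) = r :&: D) //.
      apply/setP => j; rewrite !inE; have [->|] //= := eqVneq j i.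
      by rewrite (negbTE ir).
    by rewrite lerDr; apply: sumr_ge0 => r _; case/andP: (fa01 t D r).
rewrite exchange_big; apply: ler_sum => t _ /=.
by rewrite -big_mkcond /= sumr_const -[X in X <= _]mulr_natr cardsE mulrAC.
Qed.

Theorem disjointness_corruption : 9%:R / 16%:R * (p0 - 1 / 20%:R) <= p1.
Proof.
have Z0 : 0 < Z.
  by rewrite /Z mulr_gt0 ?ltr0n // exprn_gt0 // divr_gt0 // exprn_gt0.
suff h : 9%:R / 16%:R * (p0 * Z - err - err) <= p1 * Z.
  rewrite -(ler_pM2r Z0); apply: le_trans h.
  have -> : err = 8%:R * Z / 320%:R.
    by rewrite /err /Z; set q := 2 ^+ #|I|; field.
  lra.
apply: le_trans S1; have := S0; have := bad_a; have := bad_b.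
set A := \sum_i _; set B := \sum_i _; set C := \sum_i _ => hA hB hC.
apply: (@le_trans _ _ (9%:R / 16%:R * (C - B - A))); first by rewrite ler_wpM2l //; lra.
rewrite /A /B /C -!sumrB mulr_sumr; apply: ler_sum => i _.
rewrite -!sumrB mulr_sumr; apply: ler_sum => D iD.
rewrite -!sumrB mulr_sumr; apply: ler_sum => t _.
have a0 : 0 <= lo (fa t D) i by apply: sumr_ge0 => r _; case/andP: (fa01 t D r).
have b0 : 0 <= lo (fb t (D :\ i)) i.
  by apply: sumr_ge0 => r _; case/andP: (fb01 t (D :\ i) r).
have a1 : 0 <= hi (fa t D) i by apply: sumr_ge0 => r _; case/andP: (fa01 t D r).
have b1 : 0 <= hi (fb t (D :\ i)) i.
  by apply: sumr_ge0 => r _; case/andP: (fb01 t (D :\ i) r).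
have ab0 := mulr_ge0 a0 b0; have ab1 := mulr_ge0 a1 b1.
(* If one factor is bad, the left side is at most 0. Otherwise both inequalities [3/4 * lo <= hi]
   multiply, which gives the factor 9/16. *)
rewrite /bad; case: ltrP => ha; case: ltrP => hb; try lra.
have := ler_pM _ _ ha hb; rewrite !mulr_ge0 // => /(_ isT isT).
by lra.
Qed.

End Rectangles.
End Corruption.

(** * Transcripts across a cut *)

Section Independence.
Variables (J C : finType) (Q : pred J).
Implicit Types (w : {ffun J -> C}) (f g : pred {ffun J -> C}).

Definition splice w w' : {ffun J -> C} := [ffun j => if Q j then w j else w' j].

Definition swap (p : {ffun J -> C} * {ffun J -> C}) :=
  (splice p.1 p.2, splice p.2 p.1).

Lemma swapK : involutive swap.
Proof.
by move=> [w w']; congr (_, _); apply/ffunP => j; rewrite !ffunE /=; case: (Q j).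
Qed.

(* Exchanging the coordinates outside [Q] is an involution of the pairs of
   functions. *)
Lemma independent f g :
  (forall w w', {in Q, w =1 w'} -> f w = f w') ->
  (forall w w', {in predC Q, w =1 w'} -> g w = g w') ->
  (#|[set w | f w && g w]| * #|{ffun J -> C}| =
   #|[set w | f w]| * #|[set w | g w]|)%N.
Proof.
move=> hf hg; rewrite -cardsX -(cardsT {ffun J -> C}) -cardsX.
rewrite -(on_card_preimset (onW_bij _ (inv_bij swapK))).
apply: eq_card => -[w w'] /=; rewrite !inE /= andbT; congr (_ && _).
  by apply: hf => j; rewrite unfold_in ffunE => ->.
by apply: hg => j jQ; rewrite ffunE ifN.
Qed.

End Independence.

Section Simulation.
Variables (R : realType) (n M B : nat) (A : algorithm R M B).
Notation msg := (B.-bseq bool).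
Implicit Types (G : network R n M) (S : {set 'I_n}) (v u : 'I_n).

(* The run of the vertices of [S] when the messages entering [S] are read off
   [m]; [m t u v] is the message from [u] to [v] in round [t]. *)
Fixpoint sim G S (m : nat -> 'I_n -> 'I_n -> msg) (w : 'I_n -> nat -> coin A)
    (t : nat) : 'I_n -> state A :=
  match t with
  | 0%N => fun v => init (ident G v) (view G v) (w v 0%N)
  | t'.+1 => fun v => step (sim G S m w t' v)
      [ffun j => omap (fun u => if u \in S then send (sim G S m w t' u) (ident G v)
                                else m t' u v) (neighbour G v j)]
      (w v t'.+1)
  end.

Definition agree S G G' := ident G =1 ident G' /\
  forall v u, v \in S ->
    ([set v; u]%SET \in edges G) = ([set v; u]%SET \in edges G') /\
    weight G [set v; u]%SET = weight G' [set v; u]%SET.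

Lemma neighbour_agree S G G' v j :
  agree S G G' -> v \in S -> neighbour G v j = neighbour G' v j.
Proof.
move=> [idE eE] vS; apply: eq_pick => u; rewrite /= idE.
by case: (eE v u vS) => ->.
Qed.

Lemma view_agree S G G' v : agree S G G' -> v \in S -> view G v = view G' v.
Proof.
move=> ag vS; apply/ffunP => j; rewrite !ffunE (neighbour_agree _ ag vS).
by case: (neighbour _ _ _) => //= u; case: ag => _ /(_ v u vS) [_ ->].
Qed.

Lemma neighbourP G v j u :
  neighbour G v j = Some u -> [set v; u]%SET \in edges G /\ ident G u = j.
Proof.
by rewrite /neighbour; case: pickP => // u' /andP[h /eqP <-] [<-].
Qed.

Lemma neighbour_ident G v u :
  [set v; u]%SET \in edges G -> neighbour G v (ident G u) = Some u.
Proof.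
move=> e; rewrite /neighbour; case: pickP => [u' /andP[_ /eqP/ident_inj ->] //|].
by move/(_ u); rewrite e eqxx.
Qed.

Lemma sim_agree G G' S m w w' t v : agree S G G' ->
  (forall u i, u \in S -> (i <= t)%N -> w u i = w' u i) -> v \in S ->
  sim G S m w t v = sim G' S m w' t v.
Proof.
move=> ag; elim: t v => [|t IH] v ww vS /=.
  by rewrite (view_agree ag vS) ag.1 ww.
have ww' u i : u \in S -> (i <= t)%N -> w u i = w' u i.
  by move=> uS it; apply: ww => //; apply: leqW.
rewrite IH // ww //; congr step; apply/ffunP => j; rewrite !ffunE.
rewrite (neighbour_agree _ ag vS); case: (neighbour _ _ _) => //= u.
by case: ifP => // uS; rewrite IH // ag.1.
Qed.

Definition crossing S (K : {set 'I_n * 'I_n}) G :=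
  (forall p, p \in K -> (p.1 \in S) != (p.2 \in S)) /\
  (forall u v, [set u; v]%SET \in edges G -> (u \in S) != (v \in S) -> (u, v) \in K).

Lemma run_sim G S m w T :
  (forall t u v, (t < T)%N -> [set u; v]%SET \in edges G -> u \notin S -> v \in S ->
     m t u v = send (run G w t u) (ident G v)) ->
  forall t v, (t <= T)%N -> v \in S -> sim G S m w t v = run (A := A) G w t v.
Proof.
move=> hm; elim=> [//|t IH] v tT vS /=.
rewrite IH ?(ltnW tT) //; congr step; apply/ffunP => j; rewrite !ffunE.
case e: (neighbour _ _ _) => [u|//] /=; have [uv _] := neighbourP e.
case: ifP => [uS|/negbT uS]; first by rewrite IH ?(ltnW tT).
by rewrite hm // finset.setUC.
Qed.

(** Two simulations that send each other exactly the messages recorded in [m] glue to the true run,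
    by induction on the round. *)
Lemma sim_run2 G S m w T :
  (forall t u v, (t < T)%N -> [set u; v]%SET \in edges G -> u \in S -> v \notin S ->
     send (sim G S m w t u) (ident G v) = m t u v) ->
  (forall t u v, (t < T)%N -> [set u; v]%SET \in edges G -> u \notin S -> v \in S ->
     send (sim G (~: S) m w t u) (ident G v) = m t u v) ->
  forall t v, (t <= T)%N ->
    (if v \in S then sim G S m w t v else sim G (~: S) m w t v) =
    run (A := A) G w t v.
Proof.
move=> h1 h2; elim=> [|t IH] v tT /=; first by case: ifP.
have tT' := ltnW tT.
case: ifP => vS.
  have := IH v tT'; rewrite vS => ->; congr step; apply/ffunP => j; rewrite !ffunE.
  case e: (neighbour _ _ _) => [u|//] /=; have [uv _] := neighbourP e.
  have := IH u tT'; case: ifP => [uS ->//|/negbT uS <-].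
  by rewrite h2 // finset.setUC.
have := IH v tT'; rewrite vS => ->; congr step; apply/ffunP => j; rewrite !ffunE.
case e: (neighbour _ _ _) => [u|//] /=; have [uv _] := neighbourP e.
have := IH u tT'; rewrite inE; case: ifP => [uS <-|/negbT uS ->//].
by rewrite /= h1 ?vS // finset.setUC.
Qed.

Section Transcript.
Variables (T : nat) (S : {set 'I_n}) (K : {set 'I_n * 'I_n}).

Definition transcript : finType := {ffun 'I_T * {p | p \in K} -> msg}.

Definition lookup (tau : transcript) (t : nat) u v : msg :=
  match insub t : option 'I_T, insub (u, v) : option {p | p \in K} with
  | Some t', Some p => tau (t', p)
  | _, _ => [bseq]
  end.

Lemma lookupE tau (t : 'I_T) (p : {p | p \in K}) :
  lookup tau t (val p).1 (val p).2 = tau (t, p).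
Proof. by rewrite /lookup valK -surjective_pairing valK. Qed.

Definition coins_of (w : coins (n := n) A T) : 'I_n -> nat -> coin A :=
  fun v i => w (v, inord i).

(** The vertex has terminated and chosen only edges of weight 0. This is a property of its own view
    and state, so it can be tested within one side of the cut. *)
Definition quiet_vertex (f : {ffun 'I_M -> option R}) (s : state A) : bool :=
  if out s is Some X then
    [forall j in X, if f j is Some x then x == 0 else true]
  else false.

Definition quiet G (w : coins (n := n) A T) : bool :=
  [forall v, quiet_vertex (view G v) (run_coins G w v)].

(** Only the messages leaving [S] are checked against [tau]; those entering [S] are taken from
    it. *)
Definition follows G S tau (w : coins (n := n) A T) : bool :=
  [forall q : 'I_T * {p | p \in K}, ((val q.2).1 \in S) ==>
     (send (sim G S (lookup tau) (coins_of w) q.1 (val q.2).1)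
           (ident G (val q.2).2) == tau q)].

Definition quiet_side G S tau (w : coins (n := n) A T) : bool :=
  follows G S tau w &&
  [forall v in S, quiet_vertex (view G v) (sim G S (lookup tau) (coins_of w) T v)].

Definition side_prob G S tau : R :=
  #|[set w | quiet_side G S tau w]|%:R / #|coins (n := n) A T|%:R.

Definition quiet_prob G : R :=
  #|[set w | quiet G w]|%:R / #|coins (n := n) A T|%:R.

Definition record_of G (w : coins (n := n) A T) : transcript :=
  [ffun q : 'I_T * {p | p \in K} =>
     send (run G (coins_of w) q.1 (val q.2).1) (ident G (val q.2).2)].

Lemma lookup_record G w t u v : crossing S K G -> (t < T)%N ->
  [set u; v]%SET \in edges G -> (u \in S) != (v \in S) ->
  lookup (record_of G w) t u v = send (run G (coins_of w) t u) (ident G v).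
Proof.
move=> [_ K2] tT uv /(K2 _ _ uv) uvK.
by rewrite (lookupE _ (Ordinal tT) (exist _ (u, v) uvK)) ffunE.
Qed.

(** If each side confirms what the other assumes, the simulations glue to the true run, so exactly
    one transcript is consistent with given coins. *)
Lemma follows_record G w tau : crossing S K G ->
  follows G S tau w && follows G (~: S) tau w = (tau == record_of G w).
Proof.
move=> cr; have [_ K2] := cr; apply/andP/eqP => [[/forallP h1 /forallP h2]|->].
  have h : forall t v, (t <= T)%N ->
    (if v \in S then sim G S (lookup tau) (coins_of w) t v
     else sim G (~: S) (lookup tau) (coins_of w) t v) = run G (coins_of w) t v.
    apply: sim_run2 => t u v tT uv uS vS.
      have uvK : (u, v) \in K by apply: K2; rewrite // uS (negbTE vS).
      have /= := h1 (Ordinal tT, exist _ (u, v) uvK); rewrite uS => /eqP ->.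
      by rewrite -lookupE.
    have uvK : (u, v) \in K by apply: K2; rewrite // vS (negbTE uS).
    have /= := h2 (Ordinal tT, exist _ (u, v) uvK); rewrite inE uS => /eqP ->.
    by rewrite -lookupE.
  apply/ffunP => q; rewrite ffunE -h; last exact/ltnW/ltn_ord.
  have := h1 q; have := h2 q; rewrite inE; case: ifP => _ /= /eqP.
    by move=> _ /eqP.
  by move=> ->.
have look t u v := @lookup_record G w t u v cr.
split; apply/forallP => q; apply/implyP => qS; rewrite ffunE; apply/eqP.
  rewrite (run_sim (T := T)) //; last exact/ltnW/ltn_ord.
  by move=> t u v tT uv uS vS; rewrite look // vS (negbTE uS).
rewrite (run_sim (T := T)) //; last exact/ltnW/ltn_ord.
move=> t u v tT uv; rewrite !inE negbK => uS vS.
by rewrite look // uS (negbTE vS).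
Qed.

Lemma quiet_split G w tau : crossing S K G ->
  quiet_side G S tau w && quiet_side G (~: S) tau w =
  (tau == record_of G w) && quiet G w.
Proof.
move=> cr; rewrite andbACA follows_record //.
case: eqP => //= ->.
have look t u v := @lookup_record G w t u v cr.
have r1 v : v \in S ->
    sim G S (lookup (record_of G w)) (coins_of w) T v = run G (coins_of w) T v.
  move=> vS; rewrite (run_sim (T := T)) // => t u v' tT uv uS v'S.
  by rewrite look // v'S (negbTE uS).
have r2 v : v \in ~: S ->
    sim G (~: S) (lookup (record_of G w)) (coins_of w) T v = run G (coins_of w) T v.
  move=> vS; rewrite (run_sim (T := T)) // => t u v' tT uv.
  by rewrite !inE negbK => uS v'S; rewrite look // uS (negbTE v'S).
apply/andP/forallP => [[/forallP q1 /forallP q2] v|q].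
  have := q1 v; have := q2 v; rewrite inE; case: (boolP (v \in S)) => vS /=.
    by rewrite r1.
  by rewrite r2 // inE.
by split; apply/forallP => v; apply/implyP => vS; rewrite ?r1 ?r2.
Qed.

Lemma quiet_side_agree S' G G' tau (w w' : coins (n := n) A T) : agree S' G G' ->
  (forall j, j.1 \in S' -> w j = w' j) ->
  quiet_side G S' tau w = quiet_side G' S' tau w'.
Proof.
move=> ag ww.
have sE t v : (t <= T)%N -> v \in S' ->
  sim G S' (lookup tau) (coins_of w) t v = sim G' S' (lookup tau) (coins_of w') t v.
  move=> tT vS; apply: sim_agree => // u i uS it.
  exact: ww.
congr (_ && _).
  apply: eq_forallb => q; case: (boolP (_ \in S')) => //= qS.
  by rewrite sE ?ag.1 //; exact/ltnW/ltn_ord.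
apply: eq_forallb => v; case: (boolP (_ \in S')) => //= qS.
by rewrite sE // (view_agree ag).
Qed.

Lemma coins_gt0 : (0 < #|coins (n := n) A T|)%N.
Proof. by apply/card_gt0P; exists [ffun=> coin0 A]. Qed.

(** The coin tosses are split by their transcript. For a fixed transcript the event is a conjunction
    of one event on the coins of [S] and one on the coins of the complement, which are independent;
    each side's event depends only on what that side sees of the network. *)
Lemma quiet_prob_rectangles G GA GB :
  crossing S K G -> agree S G GA -> agree (~: S) G GB ->
  quiet_prob G = \sum_tau side_prob GA S tau * side_prob GB (~: S) tau.
Proof.
move=> cr agA agB; have c0 : #|coins (n := n) A T|%:R != 0 :> R.
  by rewrite pnatr_eq0 -lt0n coins_gt0.
have -> : quiet_prob G = \sum_tau
    #|[set w | quiet_side G S tau w && quiet_side G (~: S) tau w]|%:R /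
    #|coins (n := n) A T|%:R.
  rewrite -mulr_suml -natr_sum /quiet_prob; congr (_%:R / _).
  rewrite -sum1_card (partition_big (record_of G) predT) //=.
  apply: eq_bigr => tau _; rewrite -sum1_card; apply: eq_bigl => w.
  by rewrite !inE quiet_split // andbC eq_sym.
apply: eq_bigr => tau _; rewrite /side_prob.
have -> : [set w | quiet_side G S tau w && quiet_side G (~: S) tau w] =
    [set w | quiet_side GA S tau w && quiet_side GB (~: S) tau w].
  apply/setP => w; rewrite !inE (quiet_side_agree tau (w' := w) agA) //.
  by rewrite (quiet_side_agree tau (w' := w) agB).
have /(congr1 (fun m => m%:R : R)) :
    (#|[set w | quiet_side GA S tau w && quiet_side GB (~: S) tau w]| *
       #|coins (n := n) A T| =
     #|[set w | quiet_side GA S tau w]| * #|[set w | quiet_side GB (~: S) tau w]|)%N.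
  apply: (@independent _ _ [pred j | j.1 \in S]) => w w' ww.
    by apply: quiet_side_agree => // j jS; apply: ww; rewrite inE.
  by apply: quiet_side_agree => // j jS; apply: ww; move: jS; rewrite !inE.
rewrite !natrM => e.
by apply: (mulIf c0); rewrite mulfVK // -[LHS](mulfK c0) e; field.
Qed.

End Transcript.
End Simulation.

(** * Halting probabilities *)

Section Halting.
Variables (R : realType) (n M B : nat) (A : algorithm R M B) (G : network R n M).
Local Notation coins t := (coins (n := n) A t).

Lemma le_prob t (P Q : coins t -> Prop) : (forall w, P w -> Q w) -> prob P <= prob Q.
Proof.
move=> PQ; rewrite /prob ler_wpM2r ?invr_ge0 // ler_nat subset_leq_card //.
by apply/fintype.subsetP => w; rewrite !finset.in_set => /asboolP h; apply/asboolP/PQ.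
Qed.

Lemma prob_or t (P Q : coins t -> Prop) :
  prob (fun w => P w \/ Q w) <= prob P + prob Q.
Proof.
rewrite /prob -mulrDl ler_wpM2r ?invr_ge0 // -natrD ler_nat.
apply: leq_trans (leq_card_setU _ _); rewrite subset_leq_card //.
apply/fintype.subsetP => w; rewrite finset.in_setU !finset.in_set.
by move=> /asboolP[h|h]; apply/orP; [left|right]; apply/asboolP.
Qed.

Definition restrict t t' (w : coins t') : coins t :=
  [ffun j : 'I_n * 'I_t.+1 => w (j.1, inord j.2)].

Definition override t t' (w : coins t) (w' : coins t') : coins t' :=
  [ffun j : 'I_n * 'I_t'.+1 => if (j.2 <= t)%N then w (j.1, inord j.2) else w' j].

(* Exchanging the first [t] rounds of two coin tosses is an involution of the
   pairs of coin tosses. *)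
Lemma prob_restrict t t' (P : coins t -> Prop) : (t <= t')%N ->
  prob P = prob (fun w : coins t' => P (restrict t w)).
Proof.
move=> tt'.
pose sw (p : coins t * coins t') : coins t * coins t' :=
  (restrict t p.2, override p.1 p.2).
have swK : involutive sw.
  move=> [w w']; congr (_, _); apply/ffunP => -[v i]; rewrite !ffunE /=.
    have it : (i <= t)%N by rewrite -ltnS.
    by rewrite inordK ?it ?inord_val // ltnS (leq_trans it).
  by case: ifP => it; rewrite ?it // inordK // inord_val.
have c0 : #|coins t|%:R != 0 :> R by rewrite pnatr_eq0 -lt0n coins_gt0.
have c0' : #|coins t'|%:R != 0 :> R by rewrite pnatr_eq0 -lt0n coins_gt0.
apply/eqP; rewrite /prob eqr_div // -!natrM; apply/eqP; congr (_%:R).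
rewrite -(cardsT (coins t')) -(cardsT (coins t)) [RHS]mulnC -!cardsX.
rewrite -(on_card_preimset (onW_bij _ (inv_bij swK))).
apply: eq_card => -[w w'] /=; by rewrite !inE /= andbT.
Qed.

Lemma run_ext (w w' : 'I_n -> nat -> coin A) t :
  (forall v i, (i <= t)%N -> w v i = w' v i) -> run G w t =1 run G w' t.
Proof.
elim: t => [|t IH] ww v /=; first by rewrite ww.
have {}IH : run G w t =1 run G w' t by apply: IH => u i it; rewrite ww ?leqW.
rewrite IH ww //; congr step; apply/ffunP => j; rewrite !ffunE.
by case: (neighbour _ _ _) => //= u; rewrite IH.
Qed.

Lemma run_restrict t t' (w : coins t') : (t <= t')%N ->
  run_coins G (restrict t w) =1 run G (coins_of w) t.
Proof.
move=> tt'; apply: run_ext => v i it; rewrite ffunE /coins_of /=.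
by rewrite inordK.
Qed.

Lemma out_run (w : 'I_n -> nat -> coin A) t t' v X : (t <= t')%N ->
  out (run G w t v) = Some X -> out (run G w t' v) = Some X.
Proof.
move=> /subnKC <-; elim: (t' - t)%N => [|d IH]; rewrite ?addn0 // addnS => h /=.
exact/out_step/IH.
Qed.

Lemma output_ext t t' (w : coins t) (w' : coins t') :
  (forall v, out (run_coins G w v) = out (run_coins G w' v)) ->
  output G w = output G w'.
Proof.
move=> h; apply/setP => e; rewrite !inE; congr (_ && _).
by apply: eq_existsb => v; apply: eq_existsb => u; rewrite h.
Qed.

Variables (k : nat) (alpha delta : R).
Let succ t (w : coins t) := halted G w /\ approx_spanner k alpha G (output G w).

(** Success may be reached arbitrarily late, but outputs are irrevocable: unless some vertex is
    still running at time [t], a late success is already one at time [T]. One [delta] is lost in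
    approaching the supremum, the other on the runs not halted by [t]. *)
Lemma success_by T t : 0 < delta ->
  2%:R / 3%:R <= success_prob A G k alpha ->
  (t <= T)%N -> prob (fun w : coins t => ~ halted G w) < delta ->
  2%:R / 3%:R - 2%:R * delta <= prob (@succ T).
Proof.
move=> d0 hs tT hh.
have [t1 ht1] : exists t1, 2%:R / 3%:R - delta < prob (@succ t1).
  have lt : 2%:R / 3%:R - delta < success_prob A G k alpha by lra.
  have ne : (range (fun t : nat => prob (@succ t)) !=set0)%classic.
    by exists (prob (@succ 0%N)), 0%N.
  by have [_ [t1 _ <-] h] := sup_gt ne lt; exists t1.
(* All three events are compared on the coins of one common horizon. *)
pose t2 := maxn t1 T.
have l1 : (t1 <= t2)%N := leq_maxl _ _.
have lT : (T <= t2)%N := leq_maxr _ _.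
have lt := leq_trans tT lT.
rewrite (prob_restrict _ l1) in ht1; rewrite (prob_restrict _ lt) in hh.
rewrite (prob_restrict _ lT).
have : prob (fun w : coins t2 => succ (restrict t1 w)) <=
    prob (fun w : coins t2 => succ (restrict T w) \/ ~ halted G (restrict t w)).
  apply: le_prob => w [h1 ap].
  have [ht|] := pselect (halted G (restrict t w)); [left|by right].
  have hT : halted G (restrict T w).
    move=> v; rewrite run_restrict //; have := ht v; rewrite run_restrict //.
    case e: (out _) => [X|//] _; by rewrite (out_run tT e).
  split=> //; rewrite -(output_ext (w := restrict t1 w)) // => v.
  have := h1 v; have := hT v; rewrite !run_restrict //.
  case e: (out _) => [X|//] _; case e': (out _) => [X'|//] _.
  by move: (out_run lT e) (out_run l1 e') => -> ->.
move/le_trans/(_ (prob_or _ _)).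
set x := prob _ in ht1 *; set y := prob _ in hh *; set z := prob _; lra.
Qed.

Lemma quiet_prob_prob T : quiet_prob A T G = prob (fun w : coins T => quiet G w).
Proof.
rewrite /quiet_prob /prob; congr (_%:R / _); apply: eq_card => w; rewrite !finset.in_set.
by rewrite asboolb.
Qed.

Lemma quiet_output T (w : coins T) : quiet G w ->
  forall e, e \in output G w -> weight G e = 0.
Proof.
move=> /forallP q e; rewrite inE => /andP[eE /existsP[v /existsP[u /andP[/eqP ee]]]].
have := q v; rewrite /quiet_vertex; case: (out _) => // X /forallP/(_ (ident G u)).
move=> h uX; move: h; rewrite uX /= ffunE neighbour_ident; last by rewrite -ee.
by rewrite /= -ee => /eqP.
Qed.

Lemma output_quiet T (w : coins T) : halted G w ->
  (forall e, e \in output G w -> weight G e = 0) -> quiet G w.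
Proof.
move=> h z; apply/forallP => v; rewrite /quiet_vertex; have := h v.
case o: (out _) => [X|//] _; apply/forallP => j; apply/implyP => jX.
rewrite ffunE; case e: (neighbour _ _ _) => [u|//] /=; apply/eqP/z.
have [vu uj] := neighbourP e.
rewrite inE vu; apply/existsP; exists v; apply/existsP; exists u.
by rewrite eqxx o uj.
Qed.

(** The optimum costs 0, so whatever [alpha] is, a successful output costs 0, and all its edges have
    weight 0. *)
Lemma quiet_prob_ge T p H : p <= prob (@succ T) ->
  spanner k G H -> (forall e, e \in H -> weight G e = 0) ->
  p <= quiet_prob A T G.
Proof.
move=> hp sH zH; apply: le_trans hp _; rewrite quiet_prob_prob.
have cH : cost G H = 0 by apply: big1.
have pos H' : spanner k G H' -> forall e, e \in H' -> 0 <= weight G e.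
  by move=> [/fintype.subsetP sub _] e /sub; apply: weight_ge0.
have mH : min_spanner k G H.
  split=> // H' sH'; rewrite cH; apply: sumr_ge0; exact: pos.
apply: le_prob => w [h [so /(_ H mH)]]; rewrite cH mulr0 => co.
apply: output_quiet => // e; apply: psumr_eq0P; first exact: pos.
apply/eqP; rewrite eq_le co /=; apply: sumr_ge0; exact: pos.
Qed.

(** Quiet and successful runs exclude each other, as a quiet output is too light to be a spanner. *)
Lemma quiet_prob_le T p : p <= prob (@succ T) ->
  (forall H, spanner k G H -> ~ forall e, e \in H -> weight G e = 0) ->
  quiet_prob A T G <= 1 - p.
Proof.
move=> hp hH; rewrite lerBrDr.
apply: le_trans (_ : quiet_prob A T G + prob (@succ T) <= _).
  by rewrite lerD2l.
rewrite quiet_prob_prob /prob -mulrDl ler_pdivrMr ?ltr0n ?coins_gt0 //.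
rewrite mul1r -natrD ler_nat -cardsUI.
rewrite [X in (_ + X)%N]eq_card0 ?addn0 ?max_card // => w.
rewrite finset.in_setI !finset.in_set.
apply/negP => /andP[/asboolP q /asboolP[_ [so _]]].
by apply: hH so _; apply: quiet_output.
Qed.

End Halting.

(** * Networks given by relations *)

Section Reach.
Variables (V : Type) (e : rel V).

Definition reach (t : nat) (x y : V) : Prop :=
  exists p, [/\ path e x p, last x p = y & (size p <= t)%N].

Lemma reach1 x y : e x y -> reach 1 x y.
Proof. by move=> exy; exists [:: y]; rewrite /= exy. Qed.

Lemma reach_trans t t' x y z : reach t x y -> reach t' y z -> reach (t + t') x z.
Proof.
move=> [p [pp <- sp]] [q [qq <- sq]]; exists (p ++ q).
by rewrite cat_path pp qq last_cat size_cat leq_add.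
Qed.

Lemma reachW t t' x y : (t <= t')%N -> reach t x y -> reach t' x y.
Proof. by move=> tt' [p [pp lp sp]]; exists p; split=> //; apply: leq_trans tt'. Qed.

Lemma reach_sym t x y : symmetric e -> reach t x y -> reach t y x.
Proof.
move=> es [p [pp <- sp]]; exists (rev (belast x p)).
rewrite size_rev size_belast; split=> //.
  by rewrite rev_path (eq_path (e' := e)).
by case: p {pp sp} => //= z p; rewrite rev_cons last_rcons.
Qed.

End Reach.

Section RelNetwork.
Variables (R : realType) (n M : nat) (V : finType).
Hypotheses (nM : (n <= M)%N) (cV : #|V| = n).

Definition vtx (i : 'I_n) : V := enum_val (cast_ord (esym cV) i).
Definition num (x : V) : 'I_n := cast_ord cV (enum_rank x).

Lemma vtxK : cancel vtx num.
Proof. by move=> i; rewrite /vtx /num enum_valK cast_ordKV. Qed.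

Lemma numK : cancel num vtx.
Proof. by move=> x; rewrite /vtx /num cast_ordK enum_rankK. Qed.

Definition rel_set (e : rel V) : {set {set 'I_n}} :=
  [set s | [exists u, exists v, e (vtx u) (vtx v) && (s == [set u; v]%SET)]]%SET.

Lemma rel_setE (e : rel V) u v : symmetric e ->
  ([set u; v]%SET \in rel_set e) = e (vtx u) (vtx v).
Proof.
move=> es; rewrite finset.in_set.
apply/existsP/idP => [[u' /existsP[v' /andP[e' /eqP E]]]|e0].
  have : u \in [set u'; v']%SET by rewrite -E !inE eqxx.
  have : v \in [set u'; v']%SET by rewrite -E !inE eqxx orbT.
  have : u' \in [set u; v]%SET by rewrite E !inE eqxx.
  have : v' \in [set u; v]%SET by rewrite E !inE eqxx orbT.
  rewrite !inE => h1 h2 h3 h4; move: e'.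
  case/orP: h3 h4 h1 h2 => /eqP ->; case/orP => /eqP -> //; rewrite 1?es //.
  - by rewrite !orbb => /eqP ->.
  - by rewrite !orbb => _ /eqP ->.
by exists u; apply/existsP; exists v; rewrite e0 eqxx.
Qed.

Variables (e h : rel V) (root : V).
Hypotheses (e_sym : symmetric e) (e_irr : irreflexive e) (h_sym : symmetric h).
Hypothesis e_conn : forall x, connect e x root.

Lemma rel_card2 s : s \in rel_set e -> #|s| = 2%N.
Proof.
rewrite finset.in_set => /existsP[u /existsP[v /andP[euv /eqP ->]]].
by rewrite cards2; case: eqP euv => // ->; rewrite e_irr.
Qed.

Lemma rel_connected u v : connect (fun x y => [set x; y]%SET \in rel_set e) u v.
Proof.
have c x : connect (fun x y => [set x; y]%SET \in rel_set e) (num x) (num root).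
  have /connectP[p pp ->] := e_conn x; apply/connectP; exists (map num p).
    rewrite path_map; apply: sub_path pp => y z eyz /=.
    by rewrite rel_setE // !numK.
  by rewrite last_map.
have s : connect_sym (fun x y => [set x; y]%SET \in rel_set e).
  by apply: sym_connect_sym => x y; rewrite finset.setUC.
rewrite -(vtxK u) -(vtxK v); apply: connect_trans (c _) _.
by rewrite s; apply: c.
Qed.

Definition rel_weight (s : {set 'I_n}) : R := (s \in rel_set h)%:R.

Lemma widen_ord_inj : injective (widen_ord nM).
Proof. by move=> i j /(congr1 val) /= /val_inj. Qed.

Definition rel_network : network R n M :=
  Network rel_card2 rel_connected (fun s _ => ler0n R (s \in rel_set h))
    (weight := rel_weight) widen_ord_inj.

Lemma rel_edgeE u v : ([set u; v]%SET \in edges rel_network) = e (vtx u) (vtx v).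
Proof. exact: rel_setE. Qed.

Lemma rel_weightE u v : weight rel_network [set u; v]%SET = (h (vtx u) (vtx v))%:R.
Proof. by rewrite /= /rel_weight rel_setE. Qed.

Lemma rel_weights_in (W : set R) : W 0 -> W 1 -> weights_in W rel_network.
Proof. by move=> W0 W1 s _ /=; rewrite /rel_weight; case: (_ \in _). Qed.

Lemma rel_light_spanner k :
  (forall x y, e x y -> reach (fun x y => e x y && ~~ h x y) k x y) ->
  exists2 H, spanner k rel_network H & forall s, s \in H -> weight rel_network s = 0.
Proof.
move=> hr; pose e0 x y := e x y && ~~ h x y.
have s0 : symmetric e0 by move=> x y; rewrite /e0 e_sym h_sym.
exists (rel_set e0); last first.
  move=> s; rewrite finset.in_set => /existsP[u /existsP[v /andP[/andP[_ nh] /eqP ->]]].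
  by rewrite rel_weightE (negbTE nh).
split.
  apply/fintype.subsetP => s; rewrite finset.in_set.
  move=> /existsP[u /existsP[v /andP[/andP[e' nh] /eqP ->]]].
  by rewrite rel_edgeE.
move=> u v; rewrite rel_edgeE => /hr[p [pp lp sp]].
have : path (fun x y => [set x; y]%SET \in rel_set e0) u (map num p).
  rewrite -[u]vtxK path_map; apply: sub_path pp => y z /=.
  by rewrite rel_setE // !numK.
have : last u (map num p) = v by rewrite -[u]vtxK last_map lp vtxK.
(* [reach] allows repeated vertices, whereas a spanner path is simple; shortening does not lengthen
   it. *)
move=> + pp'; case/shortenP: pp' => q qq uq sq lq.
exists q; split=> //; apply: leq_trans sp; rewrite -(size_map num p).
by apply: uniq_leq_size => //; case/andP: uq.
Qed.

(** The potential [phi] rises by at most 1 along a weightless edge, so a weightless path from [x] to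
    [y] has more than [k] edges. *)
Lemma rel_heavy_spanner k (phi : V -> nat) x y :
  (forall a b, e a b -> ~~ h a b -> (phi b <= (phi a).+1)%N) ->
  e x y -> (phi x + k < phi y)%N ->
  forall H, spanner k rel_network H -> ~ forall s, s \in H -> weight rel_network s = 0.
Proof.
move=> lip exy far H [/fintype.subsetP sub sp] w0.
have := sp (num x) (num y); rewrite rel_edgeE !numK => /(_ exy)[p [pp _ lp szp]].
suff : (phi (vtx (last (num x) p)) <= phi (vtx (num x)) + size p)%N.
  by rewrite lp !numK => hp; move: (leq_trans far hp); rewrite ltn_add2l ltnNge szp.
elim: p {lp szp} (num x) pp => [|z p IH] u /=; first by rewrite addn0.
move=> /andP[uz pz]; apply: leq_trans (IH _ pz) _.
rewrite addnS -addSn leq_add2r; apply: lip.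
  by rewrite -rel_edgeE; apply: sub.
by have := w0 _ uz; rewrite rel_weightE; case: (h _ _) => // /eqP; rewrite oner_eq0.
Qed.

End RelNetwork.

Section Sides.
Variables (R : realType) (n M : nat) (V : finType).
Variables (nM : (n <= M)%N) (cV : #|V| = n) (root : V).

Definition side (S : pred V) : {set 'I_n} := [set i | S (vtx cV i)]%SET.

Lemma rel_agree (S : pred V) (e e' h h' : rel V) es es' ei ei' ec ec' :
  symmetric h -> symmetric h' ->
  (forall x y, S x -> e x y = e' x y /\ h x y = h' x y) ->
  agree (side S) (@rel_network R n M V nM cV e h root es ei ec)
                 (@rel_network R n M V nM cV e' h' root es' ei' ec').
Proof.
move=> hs hs' E; split=> // v u; rewrite finset.in_set => vS.
have [E1 E2] := E _ (vtx cV u) vS.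
by rewrite !rel_edgeE !rel_weightE // E1 E2.
Qed.

Lemma rel_crossing (S : pred V) (c e h : rel V) es ei ec :
  (forall x y, c x y -> S x != S y) ->
  (forall x y, e x y -> S x != S y -> c x y) ->
  crossing (side S) [set p | c (vtx cV p.1) (vtx cV p.2)]%SET
    (@rel_network R n M V nM cV e h root es ei ec).
Proof.
move=> c1 c2; split=> [p|u v].
  by rewrite !finset.in_set; apply: c1.
by rewrite rel_edgeE !finset.in_set; apply: c2.
Qed.

End Sides.

(** * The disjointness network with long paths *)

Section LongPaths.
Variables (l L m : nat).

(* The four summands are the vertices [x_i], the vertices [x'_i], the paths of
   length [L] from [y_j] (position 0) to [y'_j] (position [L]), and a hub
   (number 0) together with its leaves. *)
Definition gvert : finType := ('I_l + 'I_l + 'I_l * 'I_L.+1 + 'I_m.+1)%type.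

Local Notation X i := (inl (inl (inl i)) : gvert).
Local Notation X' i := (inl (inl (inr i)) : gvert).
Local Notation Y j t := (inl (inr (j, t)) : gvert).
Local Notation Z q := (inr q : gvert).
Implicit Types (a b : {set 'I_l * 'I_l}) (x y : gvert).

Definition light_arc b x y : bool :=
  match x, y with
  | inl (inl (inl i)), inl (inl (inr i')) => i == i'
  | inl (inl (inr _)), inr q => val q == 0%N
  | inl (inl (inr i)), inl (inr (j, t)) => (val t == L) && ((i, j) \notin b)
  | inl (inr (j, t)), inl (inr (j', t')) => (j == j') && (val t' == (val t).+1)
  | inl (inr (_, t)), inr q => (val t == L) && (val q == 0%N)
  | inr q, inr q' => (val q == 0%N) && (val q' != 0%N)
  | _, _ => false
  end.

Definition heavy_arc a x y : bool :=
  match x, y with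
  | inl (inl (inl i)), inl (inr (j, t)) => (val t == 0%N) && ((i, j) \in a)
  | _, _ => false
  end.

Definition light b x y := light_arc b x y || light_arc b y x.
Definition heavy a x y := heavy_arc a x y || heavy_arc a y x.
Definition gedge a b x y := light b x y || heavy a x y.

Definition alice x : bool :=
  match x with
  | inl (inl (inl _)) => true
  | inl (inr (_, t)) => val t == 0%N
  | _ => false
  end.

Definition cut_arc x y : bool :=
  match x, y with
  | inl (inl (inl i)), inl (inl (inr i')) => i == i'
  | inl (inr (j, t)), inl (inr (j', t')) =>
      [&& j == j', val t == 0%N & val t' == 1%N]
  | _, _ => false
  end.

Definition cut x y := cut_arc x y || cut_arc y x.

Lemma light_sym b : symmetric (light b).
Proof. by move=> x y; rewrite /light orbC. Qed.

Lemma heavy_sym a : symmetric (heavy a).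
Proof. by move=> x y; rewrite /heavy orbC. Qed.

Lemma gedge_sym a b : symmetric (gedge a b).
Proof. by move=> x y; rewrite /gedge light_sym heavy_sym. Qed.

Lemma gedge_irr a b : irreflexive (gedge a b).
Proof.
move=> [[[i|i]|[j t]]|q] //; rewrite /gedge /light /heavy /=.
  by rewrite eqxx /= orbb orbF; lia.
by rewrite orbb orbF; case: eqP.
Qed.

Lemma light_heavy a b x y : light b x y -> ~~ heavy a x y.
Proof.
by case: x => [[[i|i]|[j t]]|q]; case: y => [[[i'|i']|[j' t']]|q'];
  rewrite /light /heavy.
Qed.

Lemma light_gedge a b x y :
  light b x y -> gedge a b x y && ~~ heavy a x y.
Proof. by move=> lxy; rewrite /gedge lxy (light_heavy a lxy). Qed.

Lemma reach_chain b j (t : nat) : (t <= L)%N ->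
  reach (light b) t (Y j (inord t)) (Y j ord0).
Proof.
elim: t => [_|t IH tL].
  by exists [::]; split=> //=; congr (Y _ _); apply: val_inj; rewrite /= inordK.
rewrite -[t.+1]add1n; apply: reach_trans (IH (ltnW tL)).
apply: reach1; rewrite /light /= eqxx /= !inordK ?eqxx ?orbT //.
by rewrite ltnS ltnW.
Qed.

Lemma inordL : inord L = ord_max :> 'I_L.+1.
Proof. by apply: val_inj; rewrite /= inordK. Qed.

Lemma gedge_conn a b x : connect (gedge a b) x (Z ord0).
Proof.
have c1 y z : light b y z -> connect (gedge a b) y z.
  by move=> h; apply: connect1; rewrite /gedge h.
have cX i : connect (gedge a b) (X' i) (Z ord0) by apply: c1.
case: x => [[[i|i]|[j t]]|q] //.
- by apply: connect_trans (cX i); apply: c1; rewrite /light /= eqxx.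
- have s := sym_connect_sym (gedge_sym a b).
  have toY0 t' : connect (gedge a b) (Y j t') (Y j ord0).
    have tL : (t' <= L)%N by rewrite -ltnS.
    have [p [pp lp _]] := reach_chain b j tL.
    apply/connectP; exists p; rewrite inord_val in pp lp => //.
    by apply: sub_path pp => y z h; rewrite /gedge h.
  apply: connect_trans (toY0 t) _.
  apply: (@connect_trans _ _ (Y j ord_max)); first by rewrite s.
  by apply: c1; rewrite /light /= eqxx.
- have [->|q0] := eqVneq q ord0; first exact: connect0.
  apply: c1; rewrite /light /= orbC; apply/orP; left.
  by move: q0; rewrite -val_eqE.
Qed.

(** A heavy edge from [x_i] to [y_j] is bypassed through [x'_i] and [y'_j], which are joined since
    [(i, j)] is not in [b]; the detour has 1 + 1 + L edges. *)
Lemma light_reach a b : a :&: b = finset.set0 -> forall x y, gedge a b x y ->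
  reach (fun x y => gedge a b x y && ~~ heavy a x y) L.+2 x y.
Proof.
move=> ab.
have sub t x y : reach (light b) t x y ->
    reach (fun x y => gedge a b x y && ~~ heavy a x y) t x y.
  move=> [p [pp lp sp]]; exists p; split=> //; apply: sub_path pp => u v.
  exact: light_gedge.
have arc x y : heavy_arc a x y -> reach (light b) L.+2 x y.
  case: x => [[[i|i]|[j t]]|q]; case: y => [[[i'|i']|[j' t']]|q'] //= /andP[/eqP t0 ija].
  have ijb : (i, j') \notin b.
    apply/negP => ijb; have := finset.in_set0 (i, j').
    by rewrite -ab finset.in_setI ija ijb.
  have -> : t' = ord0 by apply: val_inj.
  apply: (@reach_trans _ _ 2 L _ (Y j' (inord L))); last exact: reach_chain.
  apply: (@reach_trans _ _ 1 1 _ (X' i)); apply: reach1; rewrite /light /= ?eqxx //.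
  by rewrite inordL /= eqxx ijb.
move=> x y /orP[lxy|/orP[hxy|hyx]]; apply: sub.
- by apply: reachW (reach1 lxy).
- exact: arc.
- by apply: reach_sym (arc _ _ hyx); apply: light_sym.
Qed.

(* In the light graph, this is a 1-Lipschitz lower bound on the distance from
   the vertex [x_i] when [x'_i] and [y'_j] are not joined. *)
Definition dist_lb (i j : 'I_l) x : nat :=
  match x with
  | inl (inl (inl i')) => if i' == i then 0%N else 2%N
  | inl (inl (inr i')) => if i' == i then 1%N else 2%N
  | inl (inr (j', t)) => if j' == j then (L - t + 3)%N else 2%N
  | inr _ => 2%N
  end.

Lemma dist_lb_arc b i j x y : (i, j) \in b -> light_arc b x y ->
  (dist_lb i j y <= (dist_lb i j x).+1)%N && (dist_lb i j x <= (dist_lb i j y).+1)%N.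
Proof.
move=> ijb.
case: x => [[[i1|i1]|[j1 t1]]|q1]; case: y => [[[i2|i2]|[j2 t2]]|q2] //=.
- by move=> /eqP ->; case: ifP.
- move=> /andP[/eqP -> nb]; rewrite subnn.
  case: eqP => [ei|_]; case: eqP => [ej|_] //.
  by move: nb; rewrite ei ej ijb.
- by case: ifP.
- by move=> /andP[/eqP -> /eqP ->]; case: ifP => // _; have := ltn_ord t1; lia.
- by move=> /andP[/eqP -> _]; rewrite subnn; case: ifP.
Qed.

Lemma dist_lb_lip a b i j x y : (i, j) \in b ->
  gedge a b x y -> ~~ heavy a x y -> (dist_lb i j y <= (dist_lb i j x).+1)%N.
Proof.
move=> ijb /orP[/orP[]|->] // /(dist_lb_arc ijb)/andP[] //.
Qed.

Hypothesis L_gt0 : (0 < L)%N.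

(** The edges governed by [b] meet the paths at position [L], which differs from Alice's position 0
    as [L] is positive. *)
Lemma alice_agree a b x y : alice x -> gedge a b x y = gedge a finset.set0 x y.
Proof.
rewrite /gedge /light.
case: x => [[[i|i]|[j t]]|q]; case: y => [[[i'|i']|[j' t']]|q'] //=.
by move=> /eqP ->; rewrite !(eq_sym _ L) (gtn_eqF L_gt0).
Qed.

Lemma bob_agree a b x y : ~~ alice x ->
  gedge a b x y = gedge finset.set0 b x y /\ heavy a x y = heavy finset.set0 x y.
Proof.
move=> nx; suff h : heavy a x y = heavy finset.set0 x y by rewrite /gedge h.
move: nx; rewrite /heavy.
case: x => [[[i|i]|[j t]]|q]; case: y => [[[i'|i']|[j' t']]|q'] //=.
by move=> /negbTE ->.
Qed.

Lemma cut_alice x y : cut x y -> alice x != alice y.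
Proof.
rewrite /cut; case: x => [[[i|i]|[j t]]|q]; case: y => [[[i'|i']|[j' t']]|q'] //=.
by case/orP => /and3P[_ /eqP -> /eqP ->].
Qed.

Lemma alice_cut a b x y : gedge a b x y -> alice x != alice y -> cut x y.
Proof.
rewrite /gedge /light /heavy /cut.
case: x => [[[i|i]|[j t]]|q]; case: y => [[[i'|i']|[j' t']]|q'] //=;
  rewrite ?orbF ?orFb ?andFb //.
- by move=> /andP[/eqP ->].
- by move=> /andP[/eqP -> _]; rewrite (gtn_eqF L_gt0).
- by move=> /andP[-> _].
- by move=> /andP[/eqP -> _]; rewrite (gtn_eqF L_gt0).
- by case/orP => /andP[/eqP -> /eqP ->]; rewrite !eqxx ?eqSS eq_sym => /=;
    case: (nat_of_ord _) => // p; rewrite orbT.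
- by move=> /andP[/eqP -> _]; rewrite (gtn_eqF L_gt0).
- by move=> /andP[/eqP -> _]; rewrite (gtn_eqF L_gt0).
Qed.

(** The cut has [l] edges from [x_i] to [x'_i] and [l] first edges of paths, each in two
    directions. *)
Lemma card_cut n (cV : #|gvert| = n) :
  (#|[set p : 'I_n * 'I_n | cut (vtx cV p.1) (vtx cV p.2)]%SET| <= 4 * l)%N.
Proof.
pose o1 : 'I_L.+1 := inord 1.
pose f (q : bool * bool * 'I_l) : 'I_n * 'I_n :=
  let x := if q.1.1 then X q.2 else Y q.2 ord0 in
  let y := if q.1.1 then X' q.2 else Y q.2 o1 in
  if q.1.2 then (num cV x, num cV y) else (num cV y, num cV x).
have <- : #|[set: bool * bool * 'I_l]%SET| = (4 * l)%N.
  by rewrite cardsT !card_prod card_bool card_ord.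
apply: leq_trans (leq_imset_card f _); apply: subset_leq_card.
apply/fintype.subsetP => -[u v]; rewrite finset.in_set /=.
have arc x y : cut_arc x y ->
    exists c i, (if c then X i else Y i ord0) = x /\ (if c then X' i else Y i o1) = y.
  case: x => [[[i|i]|[j t]]|q]; case: y => [[[i'|i']|[j' t']]|q'] //=.
    by move=> /eqP <-; exists true, i.
  move=> /and3P[/eqP <- /eqP t0 /eqP t1]; exists false, j.
  by split; congr (inl (inr (_, _))); apply: val_inj; rewrite //= inordK.
case/orP => /arc[c [i [E1 E2]]]; apply/imsetP.
  by exists (c, true, i); rewrite ?finset.in_setT // -[u](vtxK cV) -[v](vtxK cV) -E1 -E2.
by exists (c, false, i); rewrite ?finset.in_setT // -[u](vtxK cV) -[v](vtxK cV) -E1 -E2.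
Qed.

End LongPaths.

(** * The 4-cycle network against zero-round algorithms *)

Section Square.
Variables (m : nat).

(* A 4-cycle, whose edges within the two sides are heavy according to [a] and
   [b], with leaves attached to one vertex; it serves the case [k = Omega(n)],
   where the long paths do not fit and only zero-round algorithms matter. *)
Definition svert : finType := (bool * bool + 'I_m)%type.
Implicit Types (a b : bool) (x y : svert).

Definition sheavy a b x y : bool :=
  match x, y with
  | inl (s, t), inl (s', t') => [&& s == s', t != t' & if s then a else b]
  | _, _ => false
  end.

Definition sedge x y : bool :=
  match x, y with
  | inl (s, t), inl (s', t') => (s == s') (+) (t == t')
  | inl (s, t), inr _ | inr _, inl (s, t) => s && t
  | _, _ => false
  end.

Definition sside x : bool := if x is inl (s, _) then s else true.

Lemma sheavy_sym a b : symmetric (sheavy a b).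
Proof. by move=> [[[] []]|q] [[[] []]|q']. Qed.

Lemma sedge_sym : symmetric sedge.
Proof. by move=> [[[] []]|q] [[[] []]|q']. Qed.

Lemma sedge_irr : irreflexive sedge.
Proof. by move=> [[[] []]|q]. Qed.

Lemma sedge_conn x : connect sedge x (inl (true, true)).
Proof.
have c t : connect sedge (inl (true, t)) (inl (true, true)).
  by case: t => //; exact: connect1.
case: x => [[[] t]|q] //; last exact: connect1.
by apply: connect_trans (c t); apply: connect1; case: t.
Qed.

(** At most one side is heavy, and its edge is bypassed by the other three edges of the cycle. *)
Lemma sedge_reach k a b : (4 <= k)%N -> a && b = false -> forall x y, sedge x y ->
  reach (fun x y => sedge x y && ~~ sheavy a b x y) k x y.
Proof.
move=> k4 ab x y exy; case: (boolP (sheavy a b x y)) => [|nh]; last first.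
  by apply: (@reachW _ _ 1); [lia|apply: reach1; rewrite exy].
case: x y {exy} => [[s t]|q] [[s' t']|q'] //= /and3P[/eqP <- tt' h].
apply: (@reachW _ _ 3); first by lia.
exists [:: inl (~~ s, t); inl (~~ s, t'); inl (s, t')]; split=> //=.
by move: h ab tt'; case: s; case: t; case: t'; case: a; case: b.
Qed.

(** When both sides are heavy, the light edges of the cycle preserve the second bit, so a jump of
    [k.+1] between its two values violates no Lipschitz condition. *)
Definition sdist k x : nat := if x is inl (_, false) then k.+1 else 0%N.

Lemma sdist_lip k x y : sedge x y -> ~~ sheavy true true x y ->
  (sdist k y <= (sdist k x).+1)%N.
Proof. by case: x => [[[] []]|q]; case: y => [[[] []]|q'] //=. Qed.

Lemma sheavy_agree s a b a' b' x y : (if s then a = a' else b = b') ->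
  sside x = s -> sheavy a b x y = sheavy a' b' x y.
Proof.
by case: x => [[s1 t1]|q] //; case: y => [[s2 t2]|q'] //= + -> => {s1}; case: s => ->.
Qed.

End Square.

(** * The reduction *)

(** Padding with [None] embeds the bit strings of length at most [B] into words of length [B] over
    three letters. *)
Lemma card_bseq_bool B : (#|{: B.-bseq bool}| <= 3 ^ B)%N.
Proof.
have sz (s : B.-bseq bool) : size (map Some s ++ nseq (B - size s) None) == B.
  by rewrite size_cat size_map size_nseq subnKC // size_bseq.
pose f s : B.-tuple (option bool) := Tuple (sz s).
have fI : injective f.
  move=> s s' /(congr1 (fun u : B.-tuple (option bool) => pmap id u)) /= E.
  have K u : pmap id (map Some u ++ nseq (B - size u) None) = u :> seq bool.
    rewrite pmap_cat map_pK //; case: (B - size u)%N => [|d]; rewrite ?cats0 //.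
    by elim: d => [|d IH]; rewrite ?cats0.
  by apply: val_inj; move: E; rewrite !K.
by have := leq_card f fI; rewrite card_tuple card_option card_bool.
Qed.

Lemma side_prob01 (R : realType) (n M B : nat) (A : algorithm R M B) T K
    (G : network R n M) S tau : 0 <= @side_prob R n M B A T K G S tau <= 1.
Proof.
rewrite /side_prob divr_ge0 //= ler_pdivrMr ?mul1r ?ler_nat ?max_card // ltr0n.
exact: coins_gt0.
Qed.

Lemma quiet_prob_le1 (R : realType) (n M B : nat) (A : algorithm R M B) T
    (G : network R n M) : quiet_prob A T G <= 1.
Proof.
rewrite /quiet_prob ler_pdivrMr ?mul1r ?ler_nat ?max_card // ltr0n.
exact: coins_gt0.
Qed.

Lemma sideC (n : nat) (V : finType) (cV : #|V| = n) (S : pred V) :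
  ~: side cV S = side cV (predC S).
Proof. by apply/setP => i; rewrite finset.in_setC !finset.in_set. Qed.

Section Reduction.
Variables (R : realType) (n M B : nat) (A : algorithm R M B) (nM : (n <= M)%N).
Variables (k T : nat) (alpha : R) (W : set R).
Hypotheses (W0 : W 0) (W1 : W 1).
Let p : R := 2%:R / 3%:R - 2%:R * (1 / 1000%:R).
Hypothesis succeeds : forall G : network R n M, weights_in W G ->
  p <= prob (fun w : coins (n := n) A T =>
               halted G w /\ approx_spanner k alpha G (output G w)).

Lemma no_fast_long_paths l L m (cV : #|gvert l L m| = n)
    (K := [set p : 'I_n * 'I_n | cut (vtx cV p.1) (vtx cV p.2)]%SET) :
  (0 < L)%N -> k = L.+2 -> (0 < l)%N ->
  640%:R * #|transcript B T K|%:R <= expR ((l * l)%:R / 128000%:R) :> R -> False.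
Proof.
move=> L0 kL l0 few.
pose G a b := rel_network R nM cV (heavy a) (@gedge_sym _ _ _ a b)
  (@gedge_irr _ _ _ a b) (gedge_conn a b).
pose S := side cV (@alice l L m).
have rect a b : quiet_prob A T (G a b) = \sum_tau
    @side_prob R n M B A T K (G a finset.set0) S tau *
    @side_prob R n M B A T K (G finset.set0 b) (~: S) tau.
  apply: quiet_prob_rectangles.
  - apply: rel_crossing; [exact: cut_alice|exact: alice_cut].
  - apply: rel_agree; try exact: heavy_sym.
    by move=> x y ax; split; [exact: alice_agree|].
  - rewrite sideC; apply: rel_agree; try exact: heavy_sym.
    by move=> x y ax; exact: bob_agree.
have h : 9%:R / 16%:R * (p - 1 / 20%:R) <= 1 - p.
  apply: (@disjointness_corruption R ('I_l * 'I_l)%type (transcript B T K)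
    (fun tau a => @side_prob R n M B A T K (G a finset.set0) S tau)
    (fun tau b => @side_prob R n M B A T K (G finset.set0 b) (~: S) tau)).
  - by move=> *; exact: side_prob01.
  - by move=> *; exact: side_prob01.
  - by move=> a b; rewrite -rect; exact: quiet_prob_le1.
  - move=> a b ab; rewrite -rect.
    have [H sH zH] := rel_light_spanner R nM cV (@gedge_sym _ _ _ a b)
      (@gedge_irr _ _ _ a b) (@heavy_sym _ _ _ a) (gedge_conn a b) (light_reach ab).
    apply: (@quiet_prob_ge _ _ _ _ _ _ k alpha _ _ H) => //; last by rewrite kL.
    by apply: succeeds; apply: rel_weights_in.
  - move=> a b [i j] ab; rewrite -rect.
    have /andP[ija ijb] : ((i, j) \in a) && ((i, j) \in b).
      by rewrite -finset.in_setI ab finset.in_set1.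
    apply: (quiet_prob_le (k := k) (alpha := alpha)).
      by apply: succeeds; apply: rel_weights_in.
    apply: (rel_heavy_spanner (@heavy_sym _ _ _ a) (phi := dist_lb i j)
      (x := inl (inl (inl i))) (y := inl (inr (j, ord0)))).
    + by move=> x y; apply: dist_lb_lip.
    + by rewrite /gedge /heavy /= ija.
    (* The potential of [y_j] is L + 3 = k + 1: even the detour through the hub is one edge too
       long. *)
    + by rewrite /= !eqxx kL; lia.
  - by rewrite card_prod card_ord muln_gt0 l0.
  - by rewrite card_prod card_ord.
(* With p = 2/3 - 1/500 the left side of [h] is about 0.346 and the right side about 0.335. *)
move: h; rewrite /p; lra.
Qed.

(** Without rounds there is a single transcript, so the probability is a product [al a * be b]. The
    two inputs with one heavy side force [p <= al true] and [p <= be true], hence [p ^ 2 <= 1 - p],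
    which is false. *)
Lemma no_fast_square m (cV : #|svert m| = n) : (4 <= k)%N -> T = 0%N -> False.
Proof.
move=> k4 T0.
pose G a b := rel_network R nM cV (sheavy a b) (@sedge_sym m)
  (@sedge_irr m) (@sedge_conn m).
pose S := side cV (@sside m).
pose c : rel (svert m) := fun x y => sside x != sside y.
pose K := [set p : 'I_n * 'I_n | c (vtx cV p.1) (vtx cV p.2)]%SET.
have rect a b : quiet_prob A T (G a b) = \sum_tau
    @side_prob R n M B A T K (G a false) S tau *
    @side_prob R n M B A T K (G false b) (~: S) tau.
  apply: quiet_prob_rectangles.
  - by apply: rel_crossing.
  - apply: rel_agree; try exact: sheavy_sym.
    by move=> x y ax; split=> //; exact: (@sheavy_agree _ true).
  - rewrite sideC; apply: rel_agree; try exact: sheavy_sym.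
    by move=> x y /negbTE ax; split=> //; exact: (@sheavy_agree _ false).
pose tau0 : transcript B T K := [ffun=> [bseq]].
have one (F : transcript B T K -> R) : \sum_tau F tau = F tau0.
  apply: big_pred1 => tau; apply/esym/eqP/ffunP => -[i q].
  by have iT := ltn_ord i; exfalso; lia.
have lo a b : a && b = false -> p <= quiet_prob A T (G a b).
  move=> ab; have [H sH zH] := rel_light_spanner R nM cV (@sedge_sym m)
      (@sedge_irr m) (@sheavy_sym _ a b) (@sedge_conn m) (sedge_reach k4 ab).
  apply: (@quiet_prob_ge _ _ _ _ _ _ k alpha _ _ H) => //.
  by apply: succeeds; apply: rel_weights_in.
have hi : quiet_prob A T (G true true) <= 1 - p.
  apply: (quiet_prob_le (k := k) (alpha := alpha)).
    by apply: succeeds; apply: rel_weights_in.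
  by apply: (rel_heavy_spanner (@sheavy_sym _ true true) (phi := sdist k)
      (x := inl (true, true)) (y := inl (true, false))) => //; exact: sdist_lip.
pose al a := @side_prob R n M B A T K (G a false) S tau0.
pose be b := @side_prob R n M B A T K (G false b) (~: S) tau0.
have rect1 a b : quiet_prob A T (G a b) = al a * be b := etrans (rect a b) (one _).
have := lo true false erefl; rewrite (rect1 true false) => h10.
have := lo false true erefl; rewrite (rect1 false true) => h01.
move: hi; rewrite (rect1 true true) => h.
have al01 a : 0 <= al a <= 1 by exact: side_prob01.
have be01 a : 0 <= be a <= 1 by exact: side_prob01.
move: (al01 true) (al01 false) (be01 true) (be01 false) h h01 h10.
move: (al true) (al false) (be true) (be false) => a1 a0 b1 b0.
move=> /andP[a1p a1q] /andP[a0p a0q] /andP[b1p b1q] /andP[b0p b0q] h h01 h10.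
have pa : p <= a1 by apply: le_trans h10 _; rewrite ler_piMr.
have pb : p <= b1 by apply: le_trans h01 _; rewrite ler_piMl.
have p0 : 0 <= p by rewrite /p; lra.
have := ler_pM p0 p0 pa pb; move: h; rewrite /p; lra.
Qed.

End Reduction.

(** * Numerical estimates *)

Section Numerics.
Variable R : realType.

Lemma ln2_ge_half : 1 / 2 <= ln 2 :> R.
Proof.
rewrite -ler_expR lnK ?posrE //.
have h := expR_ge1Dx (- (1 / 2) : R).
rewrite -[1 / 2]opprK expRN -div1r ler_pdivrMr ?expR_gt0 //.
by move: h; set e := expR _; lra.
Qed.

Lemma ln_nat_ge1 (n : nat) : (4 <= n)%N -> 1 <= ln n%:R :> R.
Proof.
move=> n4; apply: (@le_trans _ _ (ln (2 ^+ 2))).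
  by rewrite lnXn // mulr2n; have := ln2_ge_half; lra.
by rewrite ler_ln ?posrE ?exprn_gt0 ?ltr0n -?natrX ?ler_nat //; lia.
Qed.

Lemma up_log2_le (n : nat) : (4 <= n)%N -> (up_log 2 n)%:R <= 3%:R * ln n%:R :> R.
Proof.
move=> n4; have n1 : (1 < n)%N by lia.
have l1 := ln_nat_ge1 n4; have l2 := ln2_ge_half.
have h := up_log_gtn (isT : (1 < 2)%N) n1.
have u0 : (0 < up_log 2 n)%N by rewrite up_log_gt0.
have : ln (2 ^+ (up_log 2 n).-1) <= ln n%:R :> R.
  by rewrite ler_ln ?posrE ?exprn_gt0 ?ltr0n -?natrX ?ler_nat //; lia.
rewrite lnXn // -[ln 2 *+ _]mulr_natl.
have -> : (up_log 2 n).-1%:R = (up_log 2 n)%:R - 1 :> R.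
  by rewrite -subn1 natrB.
have x0 : 1 <= (up_log 2 n)%:R :> R by rewrite ler1n.
by set x := (up_log 2 n)%:R in x0 *; nra.
Qed.

Lemma card_transcript_le (n B T : nat) (K : {set 'I_n * 'I_n}) :
  #|transcript B T K|%:R <= expR (2%:R * B%:R * (T * #|K|)%:R) :> R.
Proof.
have -> : #|transcript B T K| = (#|{: B.-bseq bool}| ^ (T * #|K|))%N.
  by rewrite card_ffun card_prod card_ord card_sig.
apply: (@le_trans _ _ ((3 ^ B) ^ (T * #|K|))%:R).
  rewrite ler_nat; case: (T * #|K|)%N => [|d]; first by rewrite !expn0.
  by rewrite leq_exp2r // card_bseq_bool.
rewrite expRM_natr natrX lerXn2r ?nnegrE ?expR_ge0 //.
rewrite mulrC expRM_natl natrX lerXn2r ?nnegrE ?expR_ge0 //.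
by apply: le_trans (expR_ge1Dx _); lra.
Qed.

(** Half of the exponent pays for the transcripts. The other half is at least 10, as
    [l * l >= 4000000 >= 20 * E], and pays for 640 <= 2^10 <= e^10. *)
Lemma few_transcripts (n B T l : nat) (K : {set 'I_n * 'I_n}) (E : R) :
  0 < E -> E <= 130000%:R -> 2000%:R <= l%:R :> R ->
  2%:R * B%:R * (T * #|K|)%:R <= (l * l)%:R / (2%:R * E) ->
  640%:R * #|transcript B T K|%:R <= expR ((l * l)%:R / E).
Proof.
move=> E0 E2 l2 hT.
have -> : (l * l)%:R / E = (l * l)%:R / (2%:R * E) + (l * l)%:R / (2%:R * E).
  by field; rewrite lt0r_neq0.
rewrite expRD; apply: ler_pM; rewrite ?ler0n //; last first.
  by apply: le_trans (card_transcript_le _ _ _) _; rewrite ler_expR.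
have h : 10%:R <= (l * l)%:R / (2%:R * E).
  by rewrite natrM ler_pdivlMr ?mulr_gt0 //; nra.
apply: (@le_trans _ _ (expR 10%:R)); last by rewrite ler_expR.
rewrite -[10%:R]mul1r expRM_natr; apply: (@le_trans _ _ (2 ^+ 10)).
  by rewrite -natrX ler_nat.
by rewrite lerXn2r ?nnegrE ?expR_ge0 //; apply: le_trans (expR_ge1Dx _); lra.
Qed.

(** With [y = r * C * ln n], the cut carries an exponent of at most [8 * l * y], while [rE] and
    [n <= 4 * l * k] give [y <= l / (16 * E)]; the constant 64 is chosen to make this exactly
    [l * l / (2 * E)]. *)
Lemma round_budget (b n k l T : nat) (K : {set 'I_n * 'I_n}) (E r : R) :
  (4 <= n)%N -> 0 < k%:R :> R -> 0 < E ->
  (n <= 4 * l * k)%N -> (#|K| <= 4 * l)%N -> T%:R <= r ->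
  r * (64%:R * E * (3%:R * b%:R + 1) * k%:R * ln n%:R) = n%:R ->
  2%:R * (b * up_log 2 n)%:R * (T * #|K|)%:R <= (l * l)%:R / (2%:R * E).
Proof.
move=> n4 k0 E0 nl hK Tr rE; set C := 3%:R * b%:R + 1 in rE.
have hB : (b * up_log 2 n)%:R <= C * ln n%:R :> R.
  rewrite natrM /C mulrDl mul1r.
  have := ler_wpM2l (ler0n R b) (up_log2_le n4); have := ln_nat_ge1 n4; lra.
have hTK : (T * #|K|)%:R <= r * (4%:R * l%:R) :> R.
  by rewrite natrM ler_pM // -natrM ler_nat.
have hq : r * (C * ln n%:R) * (64%:R * E) <= 4%:R * l%:R.
  rewrite -(ler_pM2r k0).
  have -> : r * (C * ln n%:R) * (64%:R * E) * k%:R =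
      r * (64%:R * E * C * k%:R * ln n%:R) by ring.
  by rewrite rE -!natrM ler_nat.
have h1 := ler_pM (ler0n _ _) (ler0n _ _) hB hTK.
have h2 := ler_wpM2l (ler0n R l) hq.
rewrite ler_pdivlMr ?mulr_gt0 //.
have h3 := ler_wpM2r (ltW E0) h1.
rewrite [X in _ <= X]natrM; move: h2 h3; set x := _%:R * (T * _)%:R.
have -> : 2%:R * (b * up_log 2 n)%:R * (T * #|K|)%:R * (2%:R * E) = 4%:R * (x * E).
  by rewrite /x; ring.
set y := r * (C * ln n%:R).
have -> : C * ln n%:R * (r * (4%:R * l%:R)) * E = 4%:R * (l%:R * y * E).
  by rewrite /y; ring.
have -> : l%:R * (y * (64%:R * E)) = 64%:R * (l%:R * y * E) by ring.
by lra.
Qed.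

Lemma round_count (E C k x n : R) :
  0 < E -> 1 <= C -> 0 < k -> 1 <= x -> 0 <= n ->
  let r := 1 / (64%:R * E * C) * (n / (k * x)) in
  [/\ 0 < 1 / (64%:R * E * C), 0 <= r & r * (64%:R * E * C * k * x) = n].
Proof.
move=> E0 C1 k0 x1 n0 r.
have [C0 x0] : 0 < C /\ 0 < x by split; lra.
have c0 : 0 < 1 / (64%:R * E * C) by rewrite divr_gt0 // !mulr_gt0.
split=> //; first by rewrite /r mulr_ge0 ?(ltW c0) // divr_ge0 // ltW // mulr_gt0.
by rewrite /r; field; rewrite !lt0r_neq0.
Qed.

Lemma one_round (E C k x r n : R) : 2000%:R <= E -> 0 < k -> 1 <= C -> 1 <= x ->
  n <= 4000%:R * k -> r * (64%:R * E * C * k * x) = n -> r < 1.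
Proof.
move=> E1 k0 C1 x1 nk rE; rewrite ltNge; apply/negP => r1.
have E0 : 0 < E by lra.
have : 64%:R * E * k <= 64%:R * E * k * (r * (C * x)).
  apply: ler_peMr; last exact: (mulr_ege1 r1 (mulr_ege1 C1 x1)).
  by rewrite ltW // !mulr_gt0.
have -> : 64%:R * E * k * (r * (C * x)) = n by rewrite -rE; ring.
by move=> /le_trans/(_ nk); rewrite ler_pM2r //; lra.
Qed.

End Numerics.

(** An index takes up k + 1 vertices: [x_i], [x'_i] and a path of k - 1 vertices. One vertex is the
    hub, and the [m] leaves absorb the remainder of the division. *)
Lemma block_count n k : (4 <= n)%N -> (4 <= k)%N -> exists l m : nat,
  [/\ #|gvert l (k - 2) m| = n, (l < 2000)%N -> (n <= 4000 * k)%N &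
      (0 < l)%N -> (n <= 4 * l * k)%N].
Proof.
move=> n4 k4; exists (n.-1 %/ k.+1)%N, (n.-1 - (n.-1 %/ k.+1) * k.+1)%N.
have := leq_trunc_div n.-1 k.+1; have := ltn_ceil n.-1 (ltn0Sn k).
move: (n.-1 %/ k.+1)%N => l h1 h2.
rewrite !card_sum card_prod !card_ord; split=> [|hl|hl]; nia.
Qed.

Theorem theorem13 (R : realType) (b : nat) :
  exists (c delta : R) (n0 : nat),
    [/\ 0 < c, 0 < delta &
      forall (k : nat) (alpha : R), (4 <= k)%N -> 1 <= alpha ->
      forall (n M : nat), (n0 <= n)%N -> (n <= M)%N ->
      forall W : set R, W 0 -> W 1 ->
      forall A : congest_algorithm R n M b,
        approximation_algorithm n W k alpha A ->
        exists G : network R n M,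
          weights_in W G /\
          rounds_at_least A G (c * (n%:R / (k%:R * ln n%:R))) delta].
Proof.
pose C : R := 3%:R * b%:R + 1.
(* [E] is the constant in the corruption exponent; the lower bound serves [one_round], the upper one
   [few_transcripts]. *)
have [E [EE E1 E2]] : exists E : R, [/\ 128000%:R = E, 2000%:R <= E & E <= 130000%:R].
  by exists 128000%:R; split; [exact: erefl|lra|lra].
have E0 : 0 < E by lra.
have C0 : 1 <= C by rewrite /C lerDr mulr_ge0.
exists (1 / (64%:R * E * C)), (1 / 1000%:R), 4%N; split; [|lra|].
  by case: (round_count E0 C0 ltr01 (lexx 1) ler01).
move=> k alpha k4 _ n M n4 nM W W0 W1 A apx.
set r := _ * (_ / _); apply: contrapT => none.
have ln1 : 1 <= ln n%:R :> R := ln_nat_ge1 R n4.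
have k0 : 0 < k%:R :> R by rewrite ltr0n; lia.
have [_ r0 rE] := round_count E0 C0 k0 ln1 (ler0n R n); rewrite -/r in r0 rE.
pose T := Num.truncn r; have /andP[Tr rT] : T%:R <= r < T.+1%:R by exact: truncn_itv.
have succeeds (G : network R n M) : weights_in W G ->
    2%:R / 3%:R - 2%:R * (1 / 1000%:R) <=
    prob (fun w : coins (n := n) A T =>
      halted G w /\ approx_spanner k alpha G (output G w)).
  move=> wG.
  (* If the claim fails for [G], then by some time [t < r], hence [t <= T], all vertices have halted
     except with probability below 1/1000. *)
  have /existsNP[t /not_implyP[tr /negP]] : ~ rounds_at_least A G r (1 / 1000%:R).
    move=> h; apply: none; exists G; split; [exact: wG|exact: h].
  rewrite -ltNge => ht; apply: (@success_by _ _ _ _ _ _ _ _ _ T t).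
  - by lra.
  - by apply: apx.
  - by rewrite -ltnS -(ltr_nat R); apply: lt_trans rT.
  - exact: ht.
have [l [m [cV l_small l_big]]] := block_count n4 k4.
(* For small [l] the ratio [n / k] is bounded, so [r < 1] and only zero-round algorithms have to be
   excluded. *)
have [/l_small nk|l2000] := ltnP l 2000.
  have T0 : T = 0%N.
    apply/eqP; rewrite -leqn0 -ltnS -(ltr_nat R); apply: le_lt_trans Tr _.
    apply: (one_round E1 k0 C0 ln1 _ rE).
    by rewrite -natrM ler_nat.
  have cS : #|svert (n - 4)| = n.
    by rewrite card_sum card_prod card_bool card_ord subnKC.
  exact: (no_fast_square nM W0 W1 succeeds cS k4 T0).
have l0 : (0 < l)%N := ltn_trans (isT : (0 < 1999)%N) l2000.
have L0 : (0 < k - 2)%N by rewrite subn_gt0; apply: leq_trans k4.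
apply: (no_fast_long_paths nM W0 W1 succeeds (cV := cV) L0).
- by rewrite -addn2 subnK; [exact: erefl|apply: leq_trans k4].
- exact: l0.
rewrite EE; apply: (few_transcripts E0 E2); first by rewrite ler_nat.
exact: (round_budget n4 k0 E0 (l_big l0) (card_cut L0 cV) Tr rE).
Qed.
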